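(* Let $\mathcal{B}$ be a computable Boolean algebra. Then $\mathcal{B}$ is computably categorical if and only if its Stone space $\widehat{\mathcal{B}}$ is effectively categorical.
   Context: A computable Boolean algebra is computably categorical if any two computable copies of it are computably isomorphic. $\widehat{\mathcal{B}}$ denotes the space of ultrafilters of $\mathcal{B}$ (its Stone space). A computable metrization of a Polish space $M$ is a compatible complete metric $d$ together with a dense sequence $(\alpha_i)_{i\in\omega}$ with $d(\alpha_i,\alpha_j)$ uniformly computable; its basic open sets are the balls $B(\alpha_i,q)=\{x: d(\alpha_i,x)<q\}$, $q\in\mathbb{Q}^+$. Such a presentation is effectively compact if there is an effective enumeration of all finite tuples of basic open balls whose union is the whole space. For computable topological spaces $X,Y$ (with indexed bases of basic open sets), a function $f\colon X\to Y$ is effectively continuous if there is a c.e. family $F$ of pairs of (indices of) basic open sets such that (C1) for every $(U,V)\in F$, $f(U)\subseteq V$, and (C2) for every $x\in X$ and every basic open $E\ni f(x)$ there is a basic open $D\ni x$ with $(D,E)\in F$. An effectively compact Polish space $M$ is effectively categorical if for any two effectively compact presentations $X$ and $Y$ each homeomorphic to $M$, there is an effectively continuous surjective homeomorphism from $X$ onto $Y$. *)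

(* Defs.v *)
From HB Require Import structures.
From mathcomp Require Import all_boot all_order all_algebra.
From mathcomp Require Import all_classical all_reals all_analysis.

Set Implicit Arguments.
Unset Strict Implicit.
Unset Printing Implicit Defensive.

Import Order.TTheory GRing.Theory Num.Theory.

Local Open Scope classical_set_scope.

(* Total recursive functions of several arguments, generated as in Shoenfield:
   in [recursive_min] the minimization is applied only to functions having a
   zero for all values of the parameters. *)
Inductive recursive : forall n : nat, (n.-tuple nat -> nat) -> Prop :=
| recursive_zero n : @recursive n (fun=> 0)
| recursive_succ : @recursive 1 (fun v => (thead v).+1)
| recursive_proj n (i : 'I_n) : @recursive n (fun v => tnth v i)
| recursive_comp m n (f : m.-tuple nat -> nat)
    (g : 'I_m -> n.-tuple nat -> nat) :
    recursive f -> (forall i, recursive (g i)) ->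
    @recursive n (fun v => f [tuple g i v | i < m])
| recursive_primrec n (f : n.-tuple nat -> nat) (g : n.+2.-tuple nat -> nat)
    (h : n.+1.-tuple nat -> nat) :
    recursive f -> recursive g ->
    (forall v : n.-tuple nat, h [tuple of 0 :: v] = f v) ->
    (forall k (v : n.-tuple nat),
       h [tuple of k.+1 :: v] = g [tuple of k :: h [tuple of k :: v] :: v]) ->
    recursive h
| recursive_min n (f : n.+1.-tuple nat -> nat) (h : n.-tuple nat -> nat) :
    recursive f ->
    (forall v : n.-tuple nat, f [tuple of h v :: v] = 0 /\
       forall k, k < h v -> f [tuple of k :: v] <> 0) ->
    recursive h.

Definition computable_set (S : set nat) : Prop :=
  exists2 c : 1.-tuple nat -> nat, recursive c &
    forall n, c [tuple n] = `[< S n >].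

(* Used only for types built from nat by pairing and lists, where [pickle] is
   the elementary coding of the library. *)
Definition computably_enumerable (T : countType) (S : set T) : Prop :=
  S = set0 \/
  exists2 f : 1.-tuple nat -> nat, recursive f &
    pickle @` S = range (fun n => f [tuple n]).

(* A computable Boolean algebra has a computable set of natural numbers as its
   universe; here the universe is [range ba_code], and [ba_sort] is the same
   algebra presented through the library structure. *)
Record computableBooleanAlgebra := ComputableBooleanAlgebra {
  ba_disp : Order.disp_t;
  ba_sort :> ctbDistrLatticeType ba_disp;
  ba_code : ba_sort -> nat;
  ba_code_inj : injective ba_code;
  ba_range : computable_set (range ba_code);
  ba_meet : exists2 f : 2.-tuple nat -> nat, recursive f &
    forall x y, ba_code (x `&` y)%O = f [tuple ba_code x; ba_code y];
  ba_join : exists2 f : 2.-tuple nat -> nat, recursive f &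
    forall x y, ba_code (x `|` y)%O = f [tuple ba_code x; ba_code y];
  ba_compl : exists2 f : 1.-tuple nat -> nat, recursive f &
    forall x, ba_code (~` x)%O = f [tuple ba_code x]
}.

Definition boolean_isomorphism dA dB (A : ctbDistrLatticeType dA)
    (B : ctbDistrLatticeType dB) (f : A -> B) : Prop :=
  [/\ bijective f,
      f \bot%O = \bot%O /\ f \top%O = \top%O,
      forall x y, f (x `&` y)%O = (f x `&` f y)%O,
      forall x y, f (x `|` y)%O = (f x `|` f y)%O &
      forall x, f (~` x)%O = (~` f x)%O].

Definition computable_copy (A B : computableBooleanAlgebra) : Prop :=
  exists f : A -> B, boolean_isomorphism f.

Definition computably_isomorphic (A B : computableBooleanAlgebra) : Prop :=
  exists f : A -> B, boolean_isomorphism f /\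
    exists2 g : 1.-tuple nat -> nat, recursive g &
      forall x, ba_code (f x) = g [tuple ba_code x].

Definition computably_categorical (B : computableBooleanAlgebra) : Prop :=
  forall A A' : computableBooleanAlgebra,
    computable_copy A B -> computable_copy A' B -> computably_isomorphic A A'.

Section StoneSpace.
Context {d : Order.disp_t} (B : ctbDistrLatticeType d).

Definition proper_filter (F : set B) : Prop :=
  [/\ F \top%O,
      ~ F \bot%O,
      forall x y, F x -> F y -> F (x `&` y)%O &
      forall x y, F x -> (x <= y)%O -> F y].

Record stone := Stone {
  stone_set : set B;
  stone_proper : proper_filter stone_set;
  stone_max : forall G : set B,
    proper_filter G -> stone_set `<=` G -> G = stone_set
}.

HB.instance Definition _ := gen_eqMixin stone.
HB.instance Definition _ := gen_choiceMixin stone.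

Definition stone_basic (b : B) : set stone := [set U : stone | stone_set U b].

Definition stone_open : set_system stone :=
  [set O | forall U, O U -> exists2 b, stone_basic b U & stone_basic b `<=` O].

Lemma stone_openT : stone_open setT.
Proof. by move=> U _; exists \top%O => //; case: (stone_proper U). Qed.

Lemma stone_openI : setI_closed stone_open.
Proof.
move=> O1 O2 o1 o2 U [/o1[b bU bO1] /o2[c cU cO2]].
have mono (V : stone) x y : stone_set V x -> (x <= y)%O -> stone_set V y.
  by case: (stone_proper V) => _ _ _; apply.
exists (b `&` c)%O; first by case: (stone_proper U) => _ _ + _; exact.
move=> V Vbc; split.
- by apply: bO1; apply: mono Vbc _; exact: leIl.
- by apply: cO2; apply: mono Vbc _; exact: leIr.
Qed.

Lemma stone_open_bigU (I : Type) (f : I -> set stone) :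
  (forall i, stone_open (f i)) -> stone_open (\bigcup_i f i).
Proof.
move=> fo U [i _ /fo[b bU bf]]; exists b => // V /bf fV.
by exists i.
Qed.

HB.instance Definition _ :=
  isOpenTopological.Build stone stone_openT stone_openI stone_open_bigU.

End StoneSpace.

Local Open Scope ring_scope.

(* [(p v - m v) / (q v + 1)] ranges over the rationals. *)
Definition uniformly_computable (R : realType) (x : nat -> nat -> R) : Prop :=
  exists p m q : 3.-tuple nat -> nat,
    [/\ recursive p, recursive m, recursive q &
      forall i j k : nat, let v := [tuple i; j; k] in
        `|x i j - ((p v)%:R - (m v)%:R) / (q v).+1%:R| <= 2^-1 ^+ k].

(* The topology of a [metricType] is the one induced by [mdist]. *)
Record computablePolishSpace (R : realType) := ComputablePolishSpace {
  cps_sort :> metricType R;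
  cps_complete : forall F : set_system cps_sort,
    ProperFilter F -> cauchy F -> exists x : cps_sort, F --> x;
  cps_point : nat -> cps_sort;
  cps_dense : dense (range cps_point);
  cps_computable :
    uniformly_computable (fun i j => mdist (cps_point i) (cps_point j))
}.

(* The index [(i, (a, b))] denotes the ball of rational radius
   [(a + 1) / (b + 1)] around the [i]-th special point. *)
Definition ball_index : countType := (nat * (nat * nat))%type.

Definition basic_ball (R : realType) (X : computablePolishSpace R)
    (u : ball_index) : set X :=
  [set x | mdist (cps_point X u.1) x < u.2.1.+1%:R / u.2.2.+1%:R].
Arguments basic_ball {R} X u.

Definition effectively_compact (R : realType) (X : computablePolishSpace R) :
    Prop :=
  computably_enumerable
    [set s : seq ball_index | \bigcup_(u in [set` s]) basic_ball X u = setT].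

Definition homeomorphism (X Y : topologicalType) (f : X -> Y) : Prop :=
  continuous f /\
  exists g : Y -> X, [/\ cancel f g, cancel g f & continuous g].

Definition homeomorphic (X Y : topologicalType) : Prop :=
  exists f : X -> Y, homeomorphism f.

Definition effectively_continuous (R : realType)
    (X Y : computablePolishSpace R) (f : X -> Y) : Prop :=
  exists F : set (ball_index * ball_index),
    [/\ computably_enumerable F,
        forall U V, F (U, V) -> f @` basic_ball X U `<=` basic_ball Y V &
        forall (x : X) (E : ball_index), basic_ball Y E (f x) ->
          exists2 D, basic_ball X D x & F (D, E)].

Definition effectively_categorical (R : realType) (M : topologicalType) :
    Prop :=
  forall X Y : computablePolishSpace R,
    effectively_compact X -> effectively_compact Y ->
    homeomorphic X M -> homeomorphic Y M ->
    exists f : X -> Y, homeomorphism f /\ effectively_continuous f.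

(* Main.v *)
(* A computable Boolean algebra is recovered, up to computable isomorphism, from
   an effectively compact presentation X of its Stone space: a clopen set is
   named by two finite lists of balls that together cover X and are formally
   disjoint.  Such names can be enumerated, inclusion of the named sets amounts
   to a covering relation and non-inclusion is witnessed by a special point, so
   the clopen sets form a computable Boolean algebra.  A computable isomorphism
   between the algebras obtained from X and Y dualizes to an effectively
   continuous homeomorphism.
   Conversely, the Stone space of a computable algebra A carries the metric
   2^-n, n being the least code of an element on which two ultrafilters
   disagree.  Greedily chosen ultrafilters form a computable dense sequence,
   balls are computably basic clopen sets, hence the space is effectively
   compact, and the isomorphism dual to an effectively continuous homeomorphism
   is found by searching for finite covers. *)
From HB Require Import structures.
Require Import Defs.
From mathcomp Require Import all_boot all_order all_algebra.
From mathcomp Require Import all_classical all_reals all_analysis.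
From mathcomp Require Import ring lra zify.

Set Implicit Arguments.
Unset Strict Implicit.
Unset Printing Implicit Defensive.

Import Order.TTheory Order.CTheory GRing.Theory Num.Theory.

Local Open Scope classical_set_scope.

(** * Recursive functions on numbers *)

(** Few of the decisive computable functions are programmed. They are obtained by unbounded search
    in a semidecidable relation that has a solution for every argument, and decision procedures by
    semideciding a relation and its complement. What remains is to supply finite witnesses, and the
    only metric facts with finite witnesses here are strict inequalities between computable
    distances and rationals. This dictates formal disjointness, which can be confirmed at a finite
    stage, and balls of thrice the radius, which leave the room that a strict inequality needs. A
    clopen set has many names, whereas an element of a computable algebra has exactly one code. Once
    inclusion of named sets is decidable, the least name can be recognized, and search among least
    names has a unique result. *)

Lemma recursive_ext n (f g : n.-tuple nat -> nat) :
  recursive f -> f =1 g -> recursive g.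
Proof. by move=> rf /funext <-. Qed.

Definition rec1 (f : nat -> nat) : Prop :=
  recursive (fun v : 1.-tuple nat => f (tnth v ord0)).

Definition rec2 (f : nat -> nat -> nat) : Prop :=
  recursive (fun v : 2.-tuple nat => f (tnth v ord0) (tnth v (lift ord0 ord0))).

Definition rec3 (f : nat -> nat -> nat -> nat) : Prop :=
  recursive (fun v : 3.-tuple nat => f (tnth v ord0) (tnth v (lift ord0 ord0))
    (tnth v (lift ord0 (lift ord0 ord0)))).

Lemma rec1P (c : 1.-tuple nat -> nat) :
  recursive c -> rec1 (fun n => c [tuple n]).
Proof.
move=> rc; apply: (recursive_ext rc) => v; congr c; apply: eq_from_tnth => i.
by rewrite (ord1 i).
Qed.

Lemma rec2P (c : 2.-tuple nat -> nat) :
  recursive c -> rec2 (fun m n => c [tuple m; n]).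
Proof.
move=> rc; apply: (recursive_ext rc) => v; congr c; apply: eq_from_tnth => i.
by case: (unliftP ord0 i) => [j|] -> //; rewrite (ord1 j).
Qed.

Lemma rec3P (c : 3.-tuple nat -> nat) :
  recursive c -> rec3 (fun m n k => c [tuple m; n; k]).
Proof.
move=> rc; apply: (recursive_ext rc) => v; congr c; apply: eq_from_tnth => i.
case: (unliftP ord0 i) => [j|] -> //; case: (unliftP ord0 j) => [k|] -> //.
by rewrite (ord1 k).
Qed.

Lemma rec1_tuple (f : nat -> nat) : rec1 f ->
  exists2 c : 1.-tuple nat -> nat, recursive c & forall n, c [tuple n] = f n.
Proof. by move=> rf; exists (fun v => f (tnth v ord0)). Qed.

Lemma rec2_tuple (f : nat -> nat -> nat) : rec2 f ->
  exists2 c : 2.-tuple nat -> nat, recursive c &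
    forall m n, c [tuple m; n] = f m n.
Proof. by move=> rf; eexists; first exact: rf. Qed.

Lemma rec3_tuple (f : nat -> nat -> nat -> nat) : rec3 f ->
  exists2 c : 3.-tuple nat -> nat, recursive c &
    forall m n k, c [tuple m; n; k] = f m n k.
Proof. by move=> rf; eexists; first exact: rf. Qed.

Section RecursiveComposition.
Variable n : nat.
Implicit Types a b c : n.-tuple nat -> nat.

Lemma recursive_app1 f a :
  rec1 f -> recursive a -> recursive (fun v => f (a v)).
Proof.
move=> rf ra; apply: recursive_ext.
  exact: (@recursive_comp 1 n _ (fun=> a) rf (fun=> ra)).
by move=> v; rewrite tnth_mktuple.
Qed.

Lemma recursive_app2 f a b : rec2 f -> recursive a -> recursive b ->
  recursive (fun v => f (a v) (b v)).
Proof.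
move=> rf ra rb; apply: recursive_ext.
  apply: (@recursive_comp 2 n _
    (fun i : 'I_2 => if i == ord0 then a else b) rf) => i.
  by case: ifP.
by move=> v; rewrite !tnth_mktuple.
Qed.

Lemma recursive_app3 f a b c :
  rec3 f -> recursive a -> recursive b -> recursive c ->
  recursive (fun v => f (a v) (b v) (c v)).
Proof.
move=> rf ra rb rc; apply: recursive_ext.
  apply: (@recursive_comp 3 n _
    (fun i : 'I_3 => tnth [tuple a; b; c] i) rf) => i.
  case: (unliftP ord0 i) => [j|] -> //; case: (unliftP ord0 j) => [k|] -> //.
  by rewrite (ord1 k).
by move=> v; rewrite !tnth_mktuple.
Qed.

Lemma recursive_const k : @recursive n (fun=> k).
Proof.
elim: k => [|k ihk]; first exact: recursive_zero.
have rS : rec1 succn by exact: recursive_succ.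
exact: (recursive_app1 rS ihk).
Qed.

End RecursiveComposition.

Lemma rec2_primrec (f : nat -> nat) (g : nat -> nat -> nat -> nat)
    (h : nat -> nat -> nat) : rec1 f -> rec3 g ->
  (forall x, h 0 x = f x) -> (forall k x, h k.+1 x = g k (h k x) x) -> rec2 h.
Proof.
move=> rf rg h0 hS; rewrite /rec2; apply: (recursive_primrec rf rg) => [v|k v].
  by rewrite tnthS tnth0 h0.
by rewrite !tnthS !tnth0 hS.
Qed.

Ltac rectac := rewrite /rec1 /rec2 /rec3; cbv beta; repeat first
  [ exact: recursive_proj | exact: recursive_const | assumption
  | match goal with
    | H : rec1 ?f |- recursive (fun v => ?f _) =>
        apply: (recursive_app1 H)
    | H : rec2 ?f |- recursive (fun v => ?f _ _) =>
        apply: (recursive_app2 H)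
    | H : rec3 ?f |- recursive (fun v => ?f _ _ _) =>
        apply: (recursive_app3 H)
    end ].

(** Unary recursions are carried out below with a dummy second argument, which is then set to 0. *)
Lemma rec1_left (f : nat -> nat -> nat) : rec2 f -> rec1 (f^~ 0).
Proof. by move=> rf; rectac. Qed.

Lemma rec1_succ : rec1 succn.
Proof. exact: recursive_succ. Qed.

Lemma rec1_id : rec1 id.
Proof. by rectac. Qed.

Lemma rec2_add : rec2 addn.
Proof.
have rS := rec1_succ.
by apply: (@rec2_primrec id (fun k a x => a.+1)) => //; rectac.
Qed.

Lemma rec2_mul : rec2 muln.
Proof.
have rD := rec2_add.
apply: (@rec2_primrec (fun=> 0) (fun k a x => a + x)) => //; try by rectac.
by move=> k x; rewrite mulSn addnC.
Qed.

Lemma rec1_pred : rec1 predn.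
Proof.
have : rec2 (fun k x => k.-1).
  by apply: (@rec2_primrec (fun=> 0) (fun k a x => k)) => //; rectac.
exact: rec1_left.
Qed.

Lemma rec2_sub : rec2 subn.
Proof.
have r1 := rec1_pred.
(* Recursion runs on the first argument, so the subtrahend is put first; the arguments are swapped
   afterwards. *)
have r : rec2 (fun k x => x - k).
  apply: (@rec2_primrec id (fun k a x => a.-1)) => //; try by rectac.
  - by move=> x; rewrite subn0.
  - by move=> k x; rewrite subnS.
exact: (recursive_app2 r (recursive_proj (lift ord0 ord0)) (recursive_proj
  ord0)).
Qed.

Lemma rec1_exp2 : rec1 (expn 2).
Proof.
have rD := rec2_add.
have r : rec2 (fun k x => 2 ^ k).
  apply: (@rec2_primrec (fun=> 1) (fun k a x => a + a)) => //; try by rectac.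
  by move=> k _; rewrite expnS mul2n addnn.
exact: (rec1_left r).
Qed.

Lemma rec1_odd : rec1 (fun n => odd n).
Proof.
have rB := rec2_sub.
have r : rec2 (fun k x => odd k).
  apply: (@rec2_primrec (fun=> 0) (fun k a x => 1 - a)) => //; try by rectac.
  by move=> k _ /=; case: (odd k).
exact: (rec1_left r).
Qed.

Lemma rec1_half : rec1 half.
Proof.
have [rD rO] := (rec2_add, rec1_odd).
have r : rec2 (fun k x => k./2).
  apply: (@rec2_primrec (fun=> 0) (fun k a x => a + odd k)) => //.
  - by rectac.
  - by rewrite /rec3; apply: (recursive_app2 rD);
    [rectac|apply: (recursive_app1 rO); rectac].
  - by move=> k _; rewrite -[k.+1./2]/(uphalf k) uphalf_half addnC.
exact: (rec1_left r).
Qed.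

Lemma rec2_iter_half : rec2 (fun k x => iter k half x).
Proof.
have rh := rec1_half.
by apply: (@rec2_primrec id (fun k a x => a./2)) => //; rectac.
Qed.

(* [ncons], [nhd] and [ntl] are the constructor and destructors of lists of
   numbers under the bijective coding [CodeSeq.code]. *)
Definition ncons (a b : nat) : nat := 2 ^ a * b.*2.+1.
Definition nhd (n : nat) : nat := head 0 (CodeSeq.decode n).
Definition ntl (n : nat) : nat := CodeSeq.code (behead (CodeSeq.decode n)).

Lemma nconsE n : n != 0 -> n = ncons (nhd n) (ntl n).
Proof.
rewrite /nhd /ntl /ncons => n0; rewrite -{1}[n]CodeSeq.decodeK.
by case: (CodeSeq.decode n) (CodeSeq.decodeK n) n0 => [/= <-|].
Qed.

Lemma nhd_cons a b : nhd (ncons a b) = a.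
Proof.
by rewrite /nhd -[b]CodeSeq.decodeK -[ncons a _]/(CodeSeq.code (a ::
  _)) CodeSeq.codeK.
Qed.

Lemma ntl_cons a b : ntl (ncons a b) = b.
Proof.
rewrite /ntl -[b in ncons _ b]CodeSeq.decodeK.
by rewrite -[ncons a _]/(CodeSeq.code (a ::
  _)) CodeSeq.codeK /= CodeSeq.decodeK.
Qed.

Lemma iter_half_ncons a b k : k <= a -> iter k half (ncons a b) = ncons (a - k)
  b.
Proof.
elim: k => [|k ihk] ka; first by rewrite subn0.
rewrite iterS ihk ?(ltnW ka)// /ncons -(subnSK ka).
by rewrite expnS -mulnA mul2n doubleK.
Qed.

Lemma odd_ncons a b : odd (ncons a b) = (a == 0).
Proof. by rewrite /ncons oddM oddX /= odd_double /= andbT orbF. Qed.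

(** The head of a nonzero code is its exponent of 2, the least [k] such that halving [k] times gives
    an odd number. The factor [x] in [f] supplies a zero at [x = 0], so that minimization is applied
    to a function with a zero everywhere. *)
Lemma rec1_nhd : rec1 nhd.
Proof.
have [[rB rM] rO] := (rec2_sub, rec2_mul, rec1_odd); have ri := rec2_iter_half.
pose f k x := (1 - odd (iter k half x)) * x.
have rf : rec2 f.
  rewrite /rec2 /f; apply: (recursive_app2 rM); last by rectac.
  apply: (recursive_app2 rB); first by rectac.
  by apply: (recursive_app1 rO); apply: (recursive_app2 ri); rectac.
apply: (@recursive_min 1 _ _ rf) => v.
set n := tnth v ord0; rewrite /f tnthS !tnth0 -/n.
have [->|n0] := eqVneq n 0; first by rewrite muln0.
rewrite {2}(nconsE n0) iter_half_ncons// subnn odd_ncons; split=> // k kn.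
rewrite tnthS !tnth0 -/n {1}(nconsE n0) iter_half_ncons 1?ltnW// odd_ncons.
by rewrite subn_eq0 leqNgt kn /= mul1n; apply/eqP.
Qed.

Lemma ntlE n : ntl n = iter (nhd n).+1 half n.
Proof.
have [->|n0] := eqVneq n 0; first by [].
rewrite {3}(nconsE n0) iterS iter_half_ncons// subnn /ncons mul1n.
by rewrite -[_.*2.+1./2]/(uphalf _) uphalf_double.
Qed.

Lemma rec1_ntl : rec1 ntl.
Proof.
have [rS rh] := (rec1_succ, rec1_nhd); have ri := rec2_iter_half.
apply: (@recursive_ext _ (fun v => iter (nhd (tnth v ord0)).+1 half (tnth v
  ord0))).
  apply: (recursive_app2 ri); last by rectac.
  by apply: (recursive_app1 rS); rectac.
by move=> v; rewrite ntlE.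
Qed.

Lemma rec2_ncons : rec2 ncons.
Proof.
have [[[rS rM] rX] rD] := (rec1_succ, rec2_mul, rec1_exp2, rec2_add).
apply: (@recursive_ext _
  (fun v : 2.-tuple nat => 2 ^ tnth v ord0 *
     (tnth v (lift ord0 ord0) + tnth v (lift ord0 ord0)).+1)).
  apply: (recursive_app2 rM); first by rectac.
  by apply: (recursive_app1 rS); apply: (recursive_app2 rD); rectac.
by move=> v; rewrite addnn.
Qed.

(** * Computability on coded types *)

(** The tracking function [g] is total on [nat]; its values off the codes are arbitrary. *)
Definition computable (T U : countType) (f : T -> U) : Prop :=
  exists2 g, rec1 g & forall x, pickle (f x) = g (pickle x).

Lemma pickle_pairE (T U : countType) (x : T) (y : U) :
  pickle (x, y) = ncons (pickle x) (ncons (pickle y) 0).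
Proof. by []. Qed.

Lemma pickle_nilE (T : countType) : pickle ([::] : seq T) = 0.
Proof. by []. Qed.

Lemma pickle_consE (T : countType) (x : T) s :
  pickle (x :: s) = ncons (pickle x) (pickle s).
Proof. by []. Qed.

Lemma recursive_codepair n (a b : n.-tuple nat -> nat) :
  recursive a -> recursive b ->
  recursive (fun v => ncons (a v) (ncons (b v) 0)).
Proof.
move=> ra rb; apply: (recursive_app2 rec2_ncons ra).
exact: (recursive_app2 rec2_ncons rb (recursive_const _ _)).
Qed.

Lemma computable_ext (T U : countType) (f g : T -> U) :
  computable f -> f =1 g -> computable g.
Proof. by move=> cf /funext <-. Qed.

Lemma computable_rec1 (f : nat -> nat) : computable f <-> rec1 f.
Proof.
split=> [[g rg fg]|rf]; last by exists f.
by rewrite (_ : f = g) //; apply: funext.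
Qed.

Lemma computable_pickle (T : countType) : computable (@pickle T).
Proof. by exists id; first exact: rec1_id. Qed.

Section Computable.
Variables T U V W : countType.

Lemma computable_id : computable (fun x : T => x).
Proof. by exists id => //; exact: rec1_id. Qed.

Lemma computable_const (c : U) : computable (fun _ : T => c).
Proof. by exists (fun=> pickle c) => //; exact: recursive_const. Qed.

Lemma computable_comp (h : U -> V) : computable h ->
  forall f : T -> U, computable f -> computable (fun x => h (f x)).
Proof.
move=> [g rg hg] f [k rk fk]; exists (fun n => g (k n)).
  exact: (recursive_app1 rg rk).
by move=> x; rewrite hg fk.
Qed.

Lemma computable_pair (f : T -> U) (g : T -> V) :
  computable f -> computable g -> computable (fun x => (f x, g x)).
Proof.
move=> [k rk fk] [l rl gl]; exists (fun n => ncons (k n) (ncons (l n) 0)).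
  exact: recursive_codepair.
by move=> x; rewrite pickle_pairE fk gl.
Qed.

Lemma computable_fst (f : T -> U * V) :
  computable f -> computable (fun x => (f x).1).
Proof.
move=> [k rk fk]; exists (fun n => nhd (k n)).
  exact: (recursive_app1 rec1_nhd rk).
by move=> x; rewrite -fk [f x]surjective_pairing pickle_pairE nhd_cons.
Qed.

Lemma computable_snd (f : T -> U * V) :
  computable f -> computable (fun x => (f x).2).
Proof.
move=> [k rk fk]; exists (fun n => nhd (ntl (k n))).
  exact: (recursive_app1 rec1_nhd (recursive_app1 rec1_ntl rk)).
by move=> x; rewrite -fk [f x]surjective_pairing pickle_pairE ntl_cons nhd_cons.
Qed.

Lemma computable_cons (f : T -> U) (g : T -> seq U) :
  computable f -> computable g -> computable (fun x => f x :: g x).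
Proof.
move=> [k rk fk] [l rl gl]; exists (fun n => ncons (k n) (l n)).
  exact: (recursive_app2 rec2_ncons rk rl).
by move=> x; rewrite pickle_consE fk gl.
Qed.

Lemma computable_app1 (op : nat -> nat) : rec1 op ->
  forall f : T -> nat, computable f -> computable (fun x => op (f x)).
Proof.
move=> rop f [k rk fk]; exists (fun n => op (k n)).
  exact: (recursive_app1 rop rk).
by move=> x; rewrite -fk.
Qed.

Lemma computable_app2 (op : nat -> nat -> nat) : rec2 op ->
  forall f g : T -> nat, computable f -> computable g ->
  computable (fun x => op (f x) (g x)).
Proof.
move=> rop f g [k rk fk] [l rl gl]; exists (fun n => op (k n) (l n)).
  exact: (recursive_app2 rop rk rl).
by move=> x; rewrite -fk -gl.
Qed.

Lemma computable_app3 (op : nat -> nat -> nat -> nat) : rec3 op ->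
  forall f g h : T -> nat, computable f -> computable g -> computable h ->
  computable (fun x => op (f x) (g x) (h x)).
Proof.
move=> rop f g h [k rk fk] [l rl gl] [m rm hm].
exists (fun n => op (k n) (l n) (m n));
  first exact: (recursive_app3 rop rk rl rm).
by move=> x; rewrite -fk -gl -hm.
Qed.

Lemma computable_if (p : T -> bool) (f g : T -> U) :
  computable p -> computable f -> computable g ->
  computable (fun x => if p x then f x else g x).
Proof.
move=> [q rq pq] [k rk fk] [l rl gl].
exists (fun n => q n * k n + (1 - q n) * l n).
  apply: (recursive_app2 rec2_add).
    exact: (recursive_app2 rec2_mul rq rk).
  apply: (recursive_app2 rec2_mul _ rl).
  exact: (recursive_app2 rec2_sub (recursive_const _ _) rq).
move=> x; rewrite -pq -fk -gl.
by case: (p x); rewrite /= ?mul1n ?mul0n ?addn0 ?add0n.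
Qed.

(** Only the empty list has code 0, so [1 - k n] is the characteristic function of the empty case
    and the case split becomes arithmetic. *)
Lemma computable_lcase (f : T -> seq U) (b : T -> V) (c :
  T -> U -> seq U -> V) :
  computable f -> computable b ->
  computable (fun z : T * (U * seq U) => c z.1 z.2.1 z.2.2) ->
  computable (fun x => if f x is a :: s then c x a s else b x).
Proof.
move=> [k rk fk] [l rl bl] [m rm cm].
pose h n := m (ncons n (ncons (ncons (nhd (k n)) (ncons (ntl (k n)) 0)) 0)).
exists (fun n => (1 - k n) * l n + (1 - (1 - k n)) * h n).
  have r1 : rec1 (fun n => 1 - k n).
    exact: (recursive_app2 rec2_sub (recursive_const _ _) rk).
  apply: (recursive_app2 rec2_add).
    exact: (recursive_app2 rec2_mul r1 rl).
  apply: (recursive_app2 rec2_mul).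
    exact: (recursive_app2 rec2_sub (recursive_const _ _) r1).
  apply: (recursive_app1 rm); apply: (recursive_codepair (recursive_proj _)).
  apply: recursive_codepair; first exact: (recursive_app1 rec1_nhd rk).
  exact: (recursive_app1 rec1_ntl rk).
move=> x; rewrite /h -fk; case: (f x) => [|a s].
  by rewrite -bl pickle_nilE subn0 subnn mul1n mul0n addn0.
rewrite pickle_consE nhd_cons ntl_cons.
rewrite (_ : 1 - ncons _ _ = 0) ?mul0n ?add0n ?subn0 ?mul1n.
  by rewrite -[ncons (pickle a) _]pickle_pairE -pickle_pairE -cm.
by apply/eqP; rewrite subn_eq0 muln_gt0 expn_gt0.
Qed.

Lemma computable_natrec (f : T -> U) (g : T -> nat -> U -> U) (n : T -> nat) :
  computable f -> computable (fun z : T * (nat * U) => g z.1 z.2.1 z.2.2) ->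
  computable n ->
  computable (fun x => nat_rect (fun=> U) (f x) (g x) (n x)).
Proof.
move=> [k rk fk] [l rl gl] [m rm nm].
pose G i a c := l (ncons c (ncons (ncons i (ncons a 0)) 0)).
pose h i c := nat_rect (fun=> nat) (k c) (fun i a => G i a c) i.
have rG : rec3 G.
  apply: (recursive_app1 rl); apply: (recursive_codepair (recursive_proj _)).
  by apply: recursive_codepair; exact: recursive_proj.
have rh : rec2 h by exact: (rec2_primrec rk rG).
exists (fun c => h (m c) c); first exact:
  (recursive_app2 rh rm (recursive_proj _)).
move=> x; rewrite -nm -[pickle (n x)]/(n x); elim: (n x) => [|i ih] /=.
  exact: fk.
by rewrite (gl (x, (i, _))) !pickle_pairE ih.
Qed.

End Computable.

Section ComputableUncurry.
Variables T U V W S : countType.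

Lemma computable_uncurry (f : U -> V -> W) :
  computable (fun z : U * V => f z.1 z.2) ->
  forall (g : T -> U) (h : T -> V), computable g -> computable h ->
  computable (fun x => f (g x) (h x)).
Proof.
move=> cf g h cg ch.
exact: (@computable_comp _ _ _ (fun z =>
  f z.1 z.2) cf _ (computable_pair cg ch)).
Qed.

Lemma computable_uncurry3 (f : U -> V -> W -> S) :
  computable (fun z : U * (V * W) => f z.1 z.2.1 z.2.2) ->
  forall (g : T -> U) (h : T -> V) (k : T -> W),
  computable g -> computable h -> computable k ->
  computable (fun x => f (g x) (h x) (k x)).
Proof.
move=> cf g h k cg ch ck.
exact: (@computable_comp _ _ _ (fun z => f z.1 z.2.1 z.2.2) cf _
  (computable_pair cg (computable_pair ch ck))).
Qed.

End ComputableUncurry.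

(* The rules are selected by syntactic matching, since unification would unfold
   the operations in search of a projection or a conditional. *)
Ltac cmp_step := match goal with
  | |- computable (fun x => x) => exact: computable_id
  | |- computable (fun x => ?c) => exact: computable_const
  | |- computable fst => exact: (computable_fst (computable_id _))
  | |- computable snd => exact: (computable_snd (computable_id _))
  | |- computable nhd => exact/computable_rec1/rec1_nhd
  | |- computable ntl => exact/computable_rec1/rec1_ntl
  | |- computable succn => exact/computable_rec1/rec1_succ
  | |- computable (expn 2) => exact/computable_rec1/rec1_exp2
  | |- computable pickle => exact: computable_pickle
  | H : computable ?f |- computable ?f => exact: H
  | H : computable ?f |- computable (fun x => ?f (@?g x)) =>
      apply: (computable_comp H (f := g))
  | H : rec3 ?f |- computable (fun x => ?f (@?g x) (@?h x) (@?k x)) =>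
      apply: (computable_app3 H (f := g) (g := h) (h := k))
  | H : rec2 ?f |- computable (fun x => ?f (@?g x) (@?h x)) =>
      apply: (computable_app2 H (f := g) (g := h))
  | H : rec1 ?f |- computable (fun x => ?f (@?g x)) =>
      apply: (computable_app1 H (f := g))
  | H : computable (fun z => ?f z.1 z.2) |-
      computable (fun x => ?f (@?g x) (@?h x)) =>
      apply: (computable_uncurry H (g := g) (h := h))
  | H : computable (fun z => ?f z.1 z.2.1 z.2.2) |-
      computable (fun x => ?f (@?g x) (@?h x) (@?k x)) =>
      apply: (computable_uncurry3 H (g := g) (h := h) (k := k))
  | |- computable (fun x => pickle (@?f x)) =>
      apply: (computable_comp (computable_pickle _))
  | |- computable (fun x => (@?f x).1) => apply: computable_fst
  | |- computable (fun x => (@?f x).2) => apply: computable_snd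
  | |- computable (fun x => (@?f x, @?g x)) => apply: computable_pair
  | |- computable (fun x => @?f x :: @?g x) => apply: computable_cons
  | |- computable (fun x => (@?f x).+1) => apply: (computable_app1 rec1_succ)
  | |- computable (fun x => @?f x + @?g x) => apply: (computable_app2 rec2_add)
  | |- computable (fun x => @?f x - @?g x) => apply: (computable_app2 rec2_sub)
  | |- computable (fun x => @?f x * @?g x) => apply: (computable_app2 rec2_mul)
  | |- computable (fun x => 2 ^ @?f x) => apply: (computable_app1 rec1_exp2)
  | |- computable (fun x => nhd (@?f x)) => apply: (computable_app1 rec1_nhd)
  | |- computable (fun x => ntl (@?f x)) => apply: (computable_app1 rec1_ntl)
  end.

Ltac cmp := repeat (cbv beta; first [cmp_step | apply: computable_if]).

Section ComputableBool.
Variable T : countType.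
Implicit Types p q : T -> bool.

Lemma computable_neg p : computable p -> computable (fun x => ~~ p x).
Proof.
by move=> cp; apply: (@computable_ext _ _ (fun x =>
  if p x then false else true)); cmp.
Qed.

Lemma computable_and p q :
  computable p -> computable q -> computable (fun x => p x && q x).
Proof. by move=> cp cq; apply: computable_if cq _; cmp. Qed.

Lemma computable_or p q :
  computable p -> computable q -> computable (fun x => p x || q x).
Proof. by move=> cp cq; apply: computable_if cp _ cq; cmp. Qed.

Lemma computable_eqn0 (f : T -> nat) :
  computable f -> computable (fun x => f x == 0).
Proof.
move=> [k rk fk]; exists (fun n => 1 - k n).
  exact: (recursive_app2 rec2_sub (recursive_const _ _) rk).
by move=> x; rewrite -fk -[pickle (f x)]/(f x); case: (f x).
Qed.

Lemma computable_leq (f g : T -> nat) :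
  computable f -> computable g -> computable (fun x => f x <= g x).
Proof.
move=> cf cg; apply: (@computable_ext _ _ (fun x => f x - g x == 0)) => //.
by apply: computable_eqn0; cmp.
Qed.

Lemma computable_eq (U : countType) (f g : T -> U) :
  computable f -> computable g -> computable (fun x => f x == g x).
Proof.
move=> cf cg.
apply: (@computable_ext _ _
  (fun x => (pickle (f x) <= pickle (g x)) && (pickle (g x) <= pickle (f x)))).
  by apply: computable_and; apply: computable_leq; cmp.
by move=> x; rewrite -eqn_leq (inj_eq (pcan_inj pickleK)).
Qed.

End ComputableBool.

Ltac cmp_bool_step := match goal with
  | |- computable (fun x => ~~ @?p x) => apply: computable_neg
  | |- computable (fun x => @?p x && @?q x) => apply: computable_and
  | |- computable (fun x => @?p x || @?q x) => apply: computable_or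
  | |- computable (fun x => @?f x <= @?g x) => apply: computable_leq
  | |- computable (fun x => @?f x == @?g x) => apply: computable_eq
  end.

Ltac cmp ::= repeat (cbv beta;
  first [cmp_step | cmp_bool_step | apply: computable_if]).

(** Lets recursion along a list be replaced by recursion along its code. *)
Lemma size_leq_pickle (T : countType) (s : seq T) : size s <= pickle s.
Proof.
elim: s => //= a s ihs; rewrite pickle_consE /ncons.
apply: (@leq_trans (pickle s).*2.+1); last by rewrite leq_pmull// expn_gt0.
by rewrite ltnS (leq_trans ihs)// -addnn leq_addr.
Qed.

Section ComputableSeq.
Variables T A U : countType.

(** A step acts on the pair of accumulator and remaining list. Iterating it as often as the code of
    the list indicates is enough, since surplus steps fix a pair whose list is empty. *)
Lemma computable_foldl (g : T -> U -> A -> U) (f : T -> U) (s : T -> seq A) :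
  computable (fun z : T * (U * A) => g z.1 z.2.1 z.2.2) ->
  computable f -> computable s ->
  computable (fun x => foldl (g x) (f x) (s x)).
Proof.
move=> cg cf cs.
pose step x (us : U * seq A) : U * seq A :=
  if us.2 is a :: s then (g x us.1 a, s) else us.
pose F x n := nat_rect (fun=> (U * seq A)%type) (f x, s x) (fun=> step x) n.
apply: (@computable_ext _ _ (fun x => (F x (pickle (s x))).1)).
  apply: computable_fst; apply: computable_natrec; [by cmp| |by cmp].
  apply: (@computable_lcase _ _ _ (fun z : T * (nat * (U * seq A)) => z.2.2.2)
    (fun z => z.2.2) (fun z a s => (g z.1 z.2.2.1 a, s))); [by cmp..|].
  by cmp.
move=> x; rewrite /F; move: (size_leq_pickle (s x)).
set n := pickle _; rewrite -[RHS]/((foldl (g x) (f x, s x).1 (f x, s x).2)).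
have -> : size (s x) = size (f x, s x).2 by [].
(* [nat_rect] exposes the last iteration, while the induction has to peel off the first one. *)
have recS m us : nat_rect (fun=> (U * seq A)%type) us (fun=> step x) m.+1 =
    nat_rect (fun=> (U * seq A)%type) (step x us) (fun=> step x) m.
  by elim: m => //= m ->.
elim: n (f x, s x) => [|n ih] us; first by case: us => u [].
by rewrite recS; case: us => u [|a t] sn; rewrite ih.
Qed.

End ComputableSeq.

Section ComputableSeqOps.
Variables T A U : countType.

Lemma computable_rev (s : T -> seq A) :
  computable s -> computable (fun x => rev (s x)).
Proof.
move=> cs; apply: (@computable_ext _ _
  (fun x => foldl (fun u a => a :: u) [::] (s x))).
  by apply: computable_foldl; cmp.
move=> x; rewrite -[rev _]cats0; elim: (s x) [::] => //= a t ih u.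
by rewrite ih rev_cons cat_rcons.
Qed.

Lemma computable_cat (s t : T -> seq A) :
  computable s -> computable t -> computable (fun x => s x ++ t x).
Proof.
move=> cs ct; have cr := computable_rev cs; apply: (@computable_ext _ _
  (fun x => foldl (fun u a => a :: u) (t x) (rev (s x)))).
  by apply: computable_foldl; cmp.
by move=> x; rewrite foldl_rev; elim: (s x) => //= a u ->.
Qed.

Lemma computable_foldr (g : T -> A -> U -> U) (f : T -> U) (s : T -> seq A) :
  computable (fun z : T * (A * U) => g z.1 z.2.1 z.2.2) ->
  computable f -> computable s ->
  computable (fun x => foldr (g x) (f x) (s x)).
Proof.
move=> cg cf cs; have cr := computable_rev cs.
apply: (@computable_ext _ _
  (fun x => foldl (fun u a => g x a u) (f x) (rev (s x)))); last first.
  by move=> x; rewrite foldl_rev.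
apply: (@computable_foldl _ _ _ (fun x u a => g x a u)) => //.
by cmp.
Qed.

End ComputableSeqOps.

Lemma computable_map (T A U : countType) (g : T -> A -> U) (s : T -> seq A) :
  computable (fun z : T * A => g z.1 z.2) -> computable s ->
  computable (fun x => map (g x) (s x)).
Proof.
move=> cg cs; apply: (@computable_ext _ _
  (fun x => foldr (fun a u => g x a :: u) [::] (s x))); last first.
  by move=> x; elim: (s x) => //= a t ->.
apply: (@computable_foldr _ _ _ (fun x a u => g x a :: u)); [|by cmp|by cmp].
by cmp.
Qed.

Section ComputableSeqPred.
Variables T A : countType.

Lemma computable_all (g : T -> A -> bool) (s : T -> seq A) :
  computable (fun z : T * A => g z.1 z.2) -> computable s ->
  computable (fun x => all (g x) (s x)).
Proof.
move=> cg cs; apply: (@computable_ext _ _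
  (fun x => foldr (fun a u => g x a && u) true (s x))); last first.
  by move=> x; elim: (s x) => //= a t ->.
by apply: (@computable_foldr _ _ _ (fun x a u => g x a && u)); cmp.
Qed.

Lemma computable_has (g : T -> A -> bool) (s : T -> seq A) :
  computable (fun z : T * A => g z.1 z.2) -> computable s ->
  computable (fun x => has (g x) (s x)).
Proof.
move=> cg cs; apply: (@computable_ext _ _
  (fun x => ~~ all (fun a => ~~ g x a) (s x))); last first.
  by move=> x; rewrite -has_predC; apply: eq_has => a /=; rewrite negbK.
by apply: computable_neg; apply: computable_all => //; exact: computable_neg.
Qed.

Lemma computable_mem (f : T -> A) (s : T -> seq A) :
  computable f -> computable s -> computable (fun x => f x \in s x).
Proof.
move=> cf cs; apply: (@computable_ext _ _
  (fun x => has (fun a => a == f x) (s x))); last first.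
  by move=> x; rewrite has_pred1.
by apply: computable_has => //; apply: computable_eq; cmp.
Qed.

End ComputableSeqPred.

(** * Effective codings, semidecidable relations and unbounded search *)

Definition effective (T : countType) : Prop :=
  exists2 e : nat -> T, computable e & cancel pickle e.

Lemma effective_nat : effective nat.
Proof. by exists id => //; exact: computable_id. Qed.

Lemma effective_bool : effective bool.
Proof.
exists (fun n => n == 1); last by case.
by apply: computable_eq; [exact: computable_id | exact: computable_const].
Qed.

Lemma effective_pair (T U : countType) :
  effective T -> effective U -> effective (T * U)%type.
Proof.
move=> [e ce eK] [e' ce' eK']; exists (fun n => (e (nhd n), e' (nhd (ntl n)))).
  by cmp.
by move=> [x y]; rewrite pickle_pairE nhd_cons ntl_cons nhd_cons eK eK'.
Qed.

Lemma effective_seq (T : countType) : effective T -> effective (seq T).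
Proof.
move=> [e ce eK]; exists (fun n => map e (CodeSeq.decode n)).
  apply: (@computable_map _ _ _ (fun=> e)); first by cmp.
  exists id; first exact: rec1_id.
  by move=> n; rewrite -[LHS]/(CodeSeq.code (map id _)) map_id CodeSeq.decodeK.
by move=> s; rewrite /pickle /= /pickle_seq CodeSeq.codeK mapK.
Qed.

(** No monotonicity in the stage is asked, so a stage may itself code several witnesses. *)
Definition semidecidable (T : countType) (P : set T) : Prop :=
  exists2 p : T -> nat -> bool, computable (fun z : T * nat => p z.1 z.2) &
    forall x, P x <-> exists n, p x n.

Section Semidecidable.
Variable T : countType.
Implicit Types P Q : set T.

Lemma semidecidable_ext P Q :
  semidecidable P -> (forall x, P x <-> Q x) -> semidecidable Q.
Proof. by move=> [p cp Pp] PQ; exists p => // x; rewrite -PQ. Qed.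

Lemma decidable_semidecidable (p : T -> bool) :
  computable p -> semidecidable (fun x => p x).
Proof.
move=> cp; exists (fun x _ => p x) => [|x]; first by cmp.
by split=> [px|[]//]; exists 0.
Qed.

Lemma semidecidable_comp (U : countType) (Q : set U) (f : T -> U) :
  computable f -> semidecidable Q -> semidecidable (fun x => Q (f x)).
Proof. by move=> cf [q cq Qq]; exists (fun x => q (f x)) => //; cmp. Qed.

Lemma semidecidable_and P Q : semidecidable P -> semidecidable Q ->
  semidecidable (fun x => P x /\ Q x).
Proof.
move=> [p cp Pp] [q cq Qq].
exists (fun x n => p x (nhd n) && q x (ntl n)) => [|x];
  first by apply: computable_and; cmp.
rewrite Pp Qq; split=> [[[n pn] [m qm]]|[n /andP[pn qn]]].
  by exists (ncons n m); rewrite nhd_cons ntl_cons pn.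
by split; [exists (nhd n)|exists (ntl n)].
Qed.

Lemma semidecidable_or P Q : semidecidable P -> semidecidable Q ->
  semidecidable (fun x => P x \/ Q x).
Proof.
move=> [p cp Pp] [q cq Qq].
exists (fun x n => p x n || q x n) => [|x]; first by apply: computable_or; cmp.
rewrite Pp Qq; split=> [[[n pn]|[n qn]]|[n /orP[pn|qn]]].
- by exists n; rewrite pn.
- by exists n; rewrite qn orbT.
- by left; exists n.
- by right; exists n.
Qed.

Lemma semidecidable_exists (U : countType) (Q : T -> U -> Prop) : effective U ->
  semidecidable (fun z : T * U => Q z.1 z.2) ->
  semidecidable (fun x => exists y, Q x y).
Proof.
move=> [e ce eK] [q cq Qq].
exists (fun x n => q (x, e (nhd n)) (ntl n)) => [|x]; first by cmp.
split=> [[y /(Qq (x, y))[n qn]]|[n qn]].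
  by exists (ncons (pickle y) n); rewrite nhd_cons ntl_cons eK.
by exists (e (nhd n)); apply/(Qq (x, _)); exists (ntl n).
Qed.

(** Each entry of the list has its own stage. [below z n] accumulates all stages under [n], so that
    a single bound serves the whole list. *)
Lemma semidecidable_all (U : countType) (Q : T -> U -> Prop) (s : T -> seq U) :
  semidecidable (fun z : T * U => Q z.1 z.2) -> computable s ->
  semidecidable (fun x => forall y, y \in s x -> Q x y).
Proof.
move=> [q cq Qq] cs.
pose below z n := nat_rect (fun=> bool) false (fun i b => q z i || b) n.
have belowP z n : below z n <-> exists2 i, i < n & q z i.
  elim: n => [|n ih] /=; first by split=> // -[].
  split=> [/orP[qn|/ih[i ilt qi]]|[i]]; first by exists n.
    by exists i => //; exact: ltnW.
  rewrite ltnS leq_eqVlt => /orP[/eqP->->//|ilt qi].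
  by apply/orP; right; apply/ih; exists i.
exists (fun x n => all (fun y => below (x, y) n) (s x)).
  apply: (@computable_all _ _ (fun (z : T * nat) y => below (z.1, y) z.2));
    last by cmp.
  apply: computable_natrec; [by cmp| |by cmp].
  by apply: computable_or; cmp.
move=> x; split=> [H|[n /allP H] y /H/belowP[i _ qi]]; last first.
  by apply/(Qq (x, y)); exists i.
elim: (s x) H => [|y t ih] H; first by exists 0.
have [n /allP tn] := ih (fun z zt => H z (mem_behead (s := y :: t) zt)).
have [m qm] := (Qq (x, y)).1 (H y (mem_head _ _)).
exists (maxn n m.+1) => /=; apply/andP; split.
  by apply/belowP; exists m => //; rewrite leq_max leqnn orbT.
apply/allP => z /tn/belowP[i ilt qi]; apply/belowP; exists i => //.
by rewrite leq_max ilt.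
Qed.

End Semidecidable.

(* Unbounded search: [T] being effective, it can be performed on all numbers and
   not just on codes, as minimization requires. *)
Lemma computable_choice (T U : countType) (Q : T -> U -> Prop) :
  effective T -> effective U -> semidecidable (fun z : T * U => Q z.1 z.2) ->
  (forall x, exists y, Q x y) ->
  exists2 f : T -> U, computable f & forall x, Q x (f x).
Proof.
move=> [e ce eK] [d cd dK] [q cq Qq] totQ.
(* [k] codes a candidate [d (nhd k)] together with a stage [ntl k] confirming it. *)
pose p k n := q (e n, d (nhd k)) (ntl k).
have ex_p n : exists k, p k n.
  have [y Qy] := totQ (e n); have [m qm] := (Qq (e n, y)).1 Qy.
  by exists (ncons (pickle y) m); rewrite /p nhd_cons ntl_cons dK.
pose h n := ex_minn (ex_p n).
have rh : rec1 h.
  pose p' z := 1 - (p (nhd z) (nhd (ntl z)) : nat).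
  have [g rg pg] : computable (fun z => ~~ p (nhd z) (nhd (ntl z)) : bool).
    by apply: computable_neg; rewrite /p; cmp.
  have rG : rec2 (fun k n => g (ncons k (ncons n 0))).
    by apply: (recursive_app1 rg); apply: recursive_codepair;
      exact: recursive_proj.
  have GE k n : g (ncons k (ncons n 0)) = ~~ p k n.
    by rewrite -[ncons _ _]/(pickle (ncons k (ncons n 0))) -pg ntl_cons
      !nhd_cons.
  apply: (@recursive_min 1 _ _ rG) => v; rewrite tnthS !tnth0 GE /h.
  case: ex_minnP => m -> m_min; split=> // k km.
  rewrite tnthS !tnth0 GE; case: (boolP (p k _)) => // /m_min.
  by rewrite leqNgt km.
exists (fun x => d (nhd (h (pickle x)))).
  by cmp.
move=> x; rewrite /h; case: ex_minnP => m + _; rewrite /p eK => qm.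
by apply/(Qq (x, _)); exists (ntl m).
Qed.

(** Post's theorem: one searches for a truth value together with its confirmation. *)
Lemma computable_decide (T : countType) (P : set T) : effective T ->
  semidecidable P -> semidecidable (~` P) -> computable (fun x => `[< P x >]).
Proof.
move=> eT sP snP.
have [||f cf Pf] := @computable_choice T bool
    (fun x b => (b /\ P x) \/ (~~ b /\ (~` P) x)) eT effective_bool.
- apply: semidecidable_or; apply: semidecidable_and.
  + by apply: decidable_semidecidable; cmp.
  + by apply: semidecidable_comp => //; cmp.
  + by apply: decidable_semidecidable; apply: computable_neg; cmp.
  + by apply: semidecidable_comp => //; cmp.
- by move=> x; have [Px|nPx] := pselect (P x); [exists true;
  left|exists false; right].
apply: (computable_ext cf) => x; symmetry.
have [[fx Px]|[fx nPx]] := Pf x; first by rewrite fx; apply/asboolP.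
by rewrite (negbTE fx); apply/asboolPn.
Qed.

(** Unsuccessful stages output the fixed element [x0], whence the nonemptiness assumption. *)
Lemma semidecidable_enum (T : countType) (P : set T) : effective T ->
  semidecidable P -> P !=set0 ->
  exists2 f : nat -> T, computable f & range f = P.
Proof.
move=> [e ce eK] [p cp Pp] [x0 Px0].
exists (fun n => if p (e (nhd n)) (ntl n) then e (nhd n) else x0); first by cmp.
apply/seteqP; split=> [_ [n _ <-]|x /Pp[n pn]].
  by case: ifP => // pn; apply/Pp; exists (ntl n).
by exists (ncons (pickle x) n) => //; rewrite nhd_cons ntl_cons eK pn.
Qed.

Lemma semidecidable_ce (T : countType) (P : set T) : effective T ->
  semidecidable P -> computably_enumerable P.
Proof.
move=> eT sP; have [->|/set0P P0] := eqVneq P set0; [by left|right].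
have [f [g rg fg] rf] := semidecidable_enum eT sP P0.
exists (fun v => g (tnth v ord0)) => //; rewrite -rf.
apply/seteqP; split=> [_ [_ [n _ <-] <-]|_ [n _ <-]].
  by exists n => //; rewrite fg.
by exists (f n); [exists n | rewrite fg].
Qed.

Lemma ce_semidecidable (T : countType) (P : set T) :
  computably_enumerable P -> semidecidable P.
Proof.
case=> [->|[c rc Pc]].
  by exists (fun _ _ => false) => [|x]; [cmp|split=> // -[]].

have [g rg gE] : exists2 g, rec1 g & forall n, c [tuple n] = g n.
  by exists (fun n => c [tuple n]) => //; exact: rec1P.
exists (fun x n => g n == pickle x); first by apply: computable_eq; cmp.
move=> x; split=> [Px|[n /eqP gn]].
  have : (pickle @` P) (pickle x) by exists x.
  by rewrite Pc => -[n _ <-]; exists n; rewrite gE.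
have : (pickle @` P) (pickle x) by rewrite Pc -gn; exists n.
by case=> y Py /(pcan_inj pickleK) <-.
Qed.

Lemma computable_rec2 (f : nat * nat -> nat) :
  computable f -> rec2 (fun m n => f (m, n)).
Proof.
move=> [g rg fg]; have rp : rec2 (fun m n => ncons m (ncons n 0)).
  by apply: recursive_codepair; exact: recursive_proj.
apply: (recursive_ext (recursive_app1 rg rp)) => v.
by rewrite -[RHS]/(pickle (f _)) fg.
Qed.

Lemma computable_rec3 (f : nat -> nat -> nat -> nat) :
  computable (fun z : nat * (nat * nat) => f z.1 z.2.1 z.2.2) -> rec3 f.
Proof.
move=> [g rg fg].
have rp : rec3 (fun m n k => ncons m (ncons (ncons n (ncons k 0)) 0)).
  by do 2 (apply: recursive_codepair; first exact: recursive_proj);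
    exact: recursive_proj.
apply: (recursive_ext (recursive_app1 rg rp)) => v /=.
by rewrite -(fg (_, (_, _))).
Qed.

(** * Semideciding strict inequalities between distances and rationals *)

Section Distances.
Variable R : realType.
Local Open Scope ring_scope.

Lemma exp2V_lt (x : R) : 0 < x -> exists k : nat, 2^-1 ^+ k < x.
Proof.
move=> x0; have := @archi_boundP R x^-1; rewrite invr_ge0 ltW// => /(_ isT).
set k := Num.bound _ => xk; exists k.
have k2 : k%:R < 2 ^+ k :> R by rewrite -natrX ltr_nat ltn_expl.
rewrite exprVn invf_plt ?posrE ?exprn_gt0//.
exact: lt_trans xk k2.
Qed.

(** Multiplying by the positive denominators and moving the subtrahend [m] to the other side leaves
    a comparison of natural numbers, which is computable. *)
Lemma ratio_lt (p m q a b k : nat) :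
  ((p%:R - m%:R) / q.+1%:R + 2^-1 ^+ k < a%:R / b.+1%:R :> R) =
  (p * b.+1 * 2 ^ k + q.+1 * b.+1 < a * q.+1 * 2 ^ k + m * b.+1 * 2 ^ k)%N.
Proof.
rewrite -(ltr_nat R) !natrD !natrM natrX exprVn.
have q0 : q.+1%:R != 0 :> R by rewrite pnatr_eq0.
have b0 : b.+1%:R != 0 :> R by rewrite pnatr_eq0.
have e0 : (2 ^+ k : R) != 0 by rewrite expf_neq0// pnatr_eq0.
rewrite -[LHS]subr_gt0 -[RHS]subr_gt0.
have D0 : 0 < q.+1%:R * b.+1%:R * 2 ^+ k :> R.
  by rewrite !mulr_gt0 ?ltr0n ?exprn_gt0.
rewrite -[RHS](pmulr_lgt0 (x := (q.+1%:R * b.+1%:R * 2 ^+ k)^-1) _) ?invr_gt0//.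
congr (0 < (_ : R)); move: q0 b0 e0 {D0}.
move: (q.+1%:R) (b.+1%:R) (2 ^+ k : R) => Q B E q0 b0 e0; field.
by rewrite q0 b0 e0.
Qed.

Lemma ratio_gt (p m q a b k : nat) :
  (a%:R / b.+1%:R < (p%:R - m%:R) / q.+1%:R - 2^-1 ^+ k :> R) =
  (a * q.+1 * 2 ^ k + m * b.+1 * 2 ^ k + q.+1 * b.+1 < p * b.+1 * 2 ^ k)%N.
Proof.
rewrite -(ltr_nat R) !natrD !natrM natrX exprVn.
have q0 : q.+1%:R != 0 :> R by rewrite pnatr_eq0.
have b0 : b.+1%:R != 0 :> R by rewrite pnatr_eq0.
have e0 : (2 ^+ k : R) != 0 by rewrite expf_neq0// pnatr_eq0.
rewrite -[LHS]subr_gt0 -[RHS]subr_gt0.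
have D0 : 0 < q.+1%:R * b.+1%:R * 2 ^+ k :> R.
  by rewrite !mulr_gt0 ?ltr0n ?exprn_gt0.
rewrite -[RHS](pmulr_lgt0 (x := (q.+1%:R * b.+1%:R * 2 ^+ k)^-1) _) ?invr_gt0//.
congr (0 < (_ : R)); move: q0 b0 e0 {D0}.
move: (q.+1%:R) (b.+1%:R) (2 ^+ k : R) => Q B E q0 b0 e0; field.
by rewrite q0 b0 e0.
Qed.

Variable x : nat -> nat -> R.
Hypothesis cx : uniformly_computable x.

Lemma uniformly_computableP : exists p m q : nat -> nat -> nat -> nat,
  [/\ rec3 p, rec3 m, rec3 q & forall i j k,
    `|x i j - ((p i j k)%:R - (m i j k)%:R) / (q i j k).+1%:R| <= 2^-1 ^+ k].
Proof.
have [p [m [q [/rec3P rp /rec3P rm /rec3P rq xE]]]] := cx.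
by do 3 eexists; split; [exact: rp|exact: rm|exact: rq|].
Qed.

Lemma semidecidable_dist_lt : semidecidable
  (fun z : (nat * nat) * (nat * nat) => x z.1.1 z.1.2 < z.2.1%:R / z.2.2.+1%:R).
Proof.
have [p [m [q [rp rm rq xE]]]] := uniformly_computableP.
pose D z k := let i := z.1.1 in let j := z.1.2 in let a := z.2.1 in
  let b := z.2.2 in
  (p i j k * b.+1 * 2 ^ k + (q i j k).+1 * b.+1 <
   a * (q i j k).+1 * 2 ^ k + m i j k * b.+1 * 2 ^ k)%N.
exists D; first by rewrite /D /=; apply: computable_leq; cmp.
move=> [[i j] [a b]]; rewrite /D /=; split=> [lt|[k]].
  (* Half of the gap: the error of the approximation and the margin in the test each cost at most
     [2^-1 ^+ k]. *)
  have [|k] := @exp2V_lt ((a%:R / b.+1%:R - x i j) / 2).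
    by rewrite divr_gt0// subr_gt0.
  move=> ek; exists k; rewrite -(ratio_lt (p i j k)).
  have := xE i j k; rewrite ler_norml => /andP[].
  by move: (_ / (q i j k).+1%:R) (2^-1 ^+ k) (a%:R / b.+1%:R) lt ek => y e r;
    lra.
rewrite -(ratio_lt (p i j k)); have := xE i j k; rewrite ler_norml => /andP[].
by move: (_ / (q i j k).+1%:R) (2^-1 ^+ k) (a%:R / b.+1%:R) => y e r; lra.
Qed.

Lemma semidecidable_dist_gt : semidecidable
  (fun z : (nat * nat) * (nat * nat) => z.2.1%:R / z.2.2.+1%:R < x z.1.1 z.1.2).
Proof.
have [p [m [q [rp rm rq xE]]]] := uniformly_computableP.
pose D z k := let i := z.1.1 in let j := z.1.2 in let a := z.2.1 in
  let b := z.2.2 in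
  (a * (q i j k).+1 * 2 ^ k + m i j k * b.+1 * 2 ^ k + (q i j k).+1 * b.+1 <
   p i j k * b.+1 * 2 ^ k)%N.
exists D; first by rewrite /D /=; apply: computable_leq; cmp.
move=> [[i j] [a b]]; rewrite /D /=; split=> [lt|[k]].
  have [|k] := @exp2V_lt ((x i j - a%:R / b.+1%:R) / 2).
    by rewrite divr_gt0// subr_gt0.
  move=> ek; exists k; rewrite -(ratio_gt (p i j k)).
  have := xE i j k; rewrite ler_norml => /andP[].
  by move: (_ / (q i j k).+1%:R) (2^-1 ^+ k) (a%:R / b.+1%:R) lt ek => y e r;
    lra.
rewrite -(ratio_gt (p i j k)); have := xE i j k; rewrite ler_norml => /andP[].
by move: (_ / (q i j k).+1%:R) (2^-1 ^+ k) (a%:R / b.+1%:R) => y e r; lra.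
Qed.

End Distances.

Section FormalBalls.
Context {R : realType} (X : computablePolishSpace R).
Local Open Scope ring_scope.

Definition radius (u : ball_index) : R := u.2.1.+1%:R / u.2.2.+1%:R.

Lemma radius_gt0 u : 0 < radius u.
Proof. by rewrite divr_gt0 ?ltr0n. Qed.

(** Disjointness of two balls is not semidecidable in general. This condition implies it by the
    triangle inequality and, being strict, can be confirmed from approximations. *)
Definition formally_disjoint (u v : ball_index) : Prop :=
  radius u + radius v < mdist (cps_point X u.1) (cps_point X v.1).

Lemma formally_disjointP u v x :
  formally_disjoint u v -> basic_ball X u x -> basic_ball X v x -> False.
Proof.
rewrite /formally_disjoint /basic_ball /= -/(radius u) -/(radius v) => uv xu xv.
have := @metric_triangle _ _ (cps_point X u.1) x (cps_point X v.1).
by rewrite (metric_sym x); lra.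
Qed.

Lemma semidecidable_ball :
  semidecidable (fun z : nat * ball_index =>
    basic_ball X z.2 (cps_point X z.1)).
Proof.
apply: (semidecidable_comp (f := fun z : nat * ball_index =>
  ((z.2.1, z.1), (z.2.2.1.+1, z.2.2.2))) _
  (semidecidable_dist_lt (cps_computable X))).
by cmp.
Qed.

Lemma semidecidable_formally_disjoint :
  semidecidable (fun z : ball_index * ball_index => formally_disjoint z.1 z.2).
Proof.
(* [num z / (den z).+1] is the sum of the radii, as [(b + 1)(d + 1) = bd + b + d + 1]. *)
pose num (z : ball_index * ball_index) : nat :=
  (z.1.2.1.+1 * z.2.2.2.+1 + z.2.2.1.+1 * z.1.2.2.+1)%N.
pose den (z : ball_index * ball_index) : nat :=
  (z.1.2.2 * z.2.2.2 + z.1.2.2 + z.2.2.2)%N.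
apply: semidecidable_ext.
  apply: (semidecidable_comp (f := fun z : ball_index * ball_index =>
    ((z.1.1, z.2.1), (num z, den z))) _
    (semidecidable_dist_gt (cps_computable X))).
  by rewrite /num /den; cmp.
move=> [u v]; rewrite /formally_disjoint /radius /=.
have -> : (den (u, v)).+1 = (u.2.2.+1 * v.2.2.+1)%N by rewrite /den /=; lia.
rewrite /num /= natrD !natrM.
rewrite [X in X < _ <-> _](_ : _ = u.2.1.+1%:R / u.2.2.+1%:R + v.2.1.+1%:R /
  v.2.2.+1%:R) //.
have q0 : u.2.2.+1%:R != 0 :> R by rewrite pnatr_eq0.
have b0 : v.2.2.+1%:R != 0 :> R by rewrite pnatr_eq0.
by move: q0 b0; move: (u.2.2.+1%:R) (v.2.2.+1%:R) => Q B q0 b0; field;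
  rewrite q0 b0.
Qed.

End FormalBalls.

(** * Ultrafilters and Stone duality *)

Section Ultrafilters.
Context {d : Order.disp_t} {B : ctbDistrLatticeType d}.
Implicit Types (U V : stone B) (b c : B) (s : seq B).

Lemma stoneT U : stone_set U \top%O.
Proof. by case: (stone_proper U). Qed.

Lemma stone0 U : ~ stone_set U \bot%O.
Proof. by case: (stone_proper U). Qed.

Lemma stoneS U b c : (b <= c)%O -> stone_set U b -> stone_set U c.
Proof. by move=> bc Ub; case: (stone_proper U) => _ _ _ /(_ _ _ Ub bc). Qed.

Lemma stoneI U b c : stone_set U (b `&` c)%O <-> stone_set U b /\ stone_set U c.
Proof.
split=> [Ubc|[Ub Uc]]; last by case: (stone_proper U) => _ _ /(_ _ _ Ub Uc).
by split; apply: stoneS Ubc; [exact: leIl|exact: leIr].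
Qed.

(** If [b] is not in [U], the filter generated by [U] and the complement of [b] is proper: otherwise
    some [u] in [U] would lie below [b]. Maximality then puts the complement in [U]. *)
Lemma stoneC U b : stone_set U (~` b)%O <-> ~ stone_set U b.
Proof.
split=> [UCb Ub|nUb].
  by apply: (@stone0 U); rewrite -(meetxC b); apply/stoneI.
pose G : set B := [set c | exists2 u, stone_set U u & (u `&` ~` b <= c)%O].
apply: contrapT => nUCb.
have : proper_filter G.
  split.
  - by exists \top%O; [exact: stoneT|exact: lex1].
  - by case=> u Uu; rewrite lex0 disj_leC complK => /stoneS/(_ Uu).
  - move=> x y [u Uu ux] [v Uv vy]; exists (u `&` v)%O; first exact/stoneI.
    rewrite lexI; apply/andP; split; [apply: le_trans ux|apply: le_trans vy].
      by rewrite leI2// leIl.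
    by rewrite leI2// leIr.
  - by move=> x y [u Uu ux] xy; exists u => //; exact: le_trans xy.
move=> /(stone_max (s := U)) GU; apply: nUCb; rewrite -GU.
  by exists \top%O; [exact: stoneT|rewrite meet1x].
by move=> c Uc; exists c => //; exact: leIl.
Qed.

Lemma stoneU U b c : stone_set U (b `|` c)%O <-> stone_set U b \/ stone_set U c.
Proof.
split=> [Ubc|[]]; last 2 first.
- by apply: stoneS; exact: leUl.
- by apply: stoneS; exact: leUr.
have [Ub|/stoneC nUb] := pselect (stone_set U b); [by left|right].
have := (stoneI U _ _).2 (conj Ubc nUb).
by rewrite meetUl meetxC join0x => /stoneI[].
Qed.

(** Maximality of [U] turns the one-sided inclusion into an equality. *)
Lemma stone_ext U V : (forall b, stone_set U b -> stone_set V b) -> U = V.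
Proof.
move=> UV; have E : stone_set V = stone_set U by apply:
  stone_max (stone_proper V) UV.
case: U V E {UV} => [F p m] [G q n] /= E; subst G.
by congr Stone; exact: Prop_irrelevance.
Qed.

Lemma stone_exists (F : set B) : proper_filter F ->
  (forall b, F b \/ F (~` b)%O) -> exists U : stone B, stone_set U = F.
Proof.
move=> pF uF; suff mF G : proper_filter G -> F `<=` G -> G = F.
  by exists (Stone pF mF).
move=> [_ G0 GI _] FG; apply/seteqP; split=> // b Gb.
have [//|/FG GCb] := uF b; exfalso; apply: G0.
by rewrite -(meetxC b); exact: GI.
Qed.

Definition joins s : B := foldr Order.join \bot%O s.

Lemma joinsP U s : stone_set U (joins s) <-> exists2 b, b \in s & stone_set U b.
Proof.
elim: s => /= [|a s ih]; first by split=> [/stone0|[]].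
rewrite stoneU ih; split=> [[Ua|[b bs Ub]]|[b]].
- by exists a; rewrite ?mem_head.
- by exists b; rewrite ?inE ?bs ?orbT.
- by rewrite inE => /orP[/eqP->|bs Ub]; [left|right; exists b].
Qed.

Lemma le_joins b s : b \in s -> (b <= joins s)%O.
Proof.
elim: s => //= a s ih; rewrite inE => /orP[/eqP->|/ih bs]; first exact: leUl.
by apply: le_trans bs _; exact: leUr.
Qed.

Lemma joins_le b s : {in s, forall c, c <= b}%O -> (joins s <= b)%O.
Proof.
elim: s => /= [_|a s ih sb]; first exact: le0x.
rewrite leUx sb ?mem_head//= ih// => c cs.
by rewrite sb// inE cs orbT.
Qed.

(* Deciding one element after the other while staying outside of the ideal [I]
   leads from any [b] outside of [I] to an ultrafilter through [b] avoiding
   [I]. For [I] reduced to [\bot] the choices are effective. *)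
Section Greedy.
Variables (el : nat -> B) (I : pred B).

Fixpoint greedy b n : B :=
  if n is m.+1 then
    let c := greedy b m in
    if I (c `&` el m)%O then (c `&` ~` el m)%O else (c `&` el m)%O
  else b.

Hypothesis el_surj : forall b, exists n, el n = b.
Hypothesis I0 : I \bot%O.
Hypothesis I_le : forall b c, (b <= c)%O -> I c -> I b.
Hypothesis I_join : forall b c, I b -> I c -> I (b `|` c)%O.

Lemma greedy_le b m n : m <= n -> (greedy b n <= greedy b m)%O.
Proof.
elim: n => [|n ih]; first by rewrite leqn0 => /eqP->.
rewrite leq_eqVlt => /orP[/eqP->//|]; rewrite ltnS => /ih;
  apply: le_trans => /=.
by case: ifP => _; exact: leIl.
Qed.

Lemma greedy_notin b n : ~~ I b -> ~~ I (greedy b n).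
Proof.
move=> nIb; elim: n => //= n ih; case: ifPn => // In.
apply: contra ih => InC; rewrite -(meetx1 (greedy b n)) -(joinxC (el n)) meetUr.
exact: I_join.
Qed.

(** The decreasing sequence [greedy b n] generates a filter that decides [el m] at step [m.+1]; it
    avoids [I] because no term of the sequence is in the down-closed set [I]. *)
Lemma greedy_stone b : ~~ I b -> exists2 U : stone B,
    (forall c, stone_set U c <-> exists n, (greedy b n <= c)%O) &
  stone_set U b /\ forall c, stone_set U c -> ~~ I c.
Proof.
move=> nIb; have notI c n : (greedy b n <= c)%O -> ~~ I c.
  by move=> cn; apply/negP => /(I_le cn); exact/negP/greedy_notin.
have [||U UE] := @stone_exists [set c | exists n, (greedy b n <= c)%O].
- split.
  + by exists 0; exact: lex1.
  + by case=> n /notI; rewrite I0.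
  + move=> x y [m mx] [n ny]; exists (maxn m n); rewrite lexI.
    by rewrite (le_trans _ mx) ?(le_trans _ ny)// greedy_le ?leq_maxl ?leq_maxr.
  + by move=> x y [n nx] xy; exists n; exact: le_trans xy.
- move=> c; have [m <-] := el_surj c.
  have : (greedy b m.+1 <= el m)%O \/ (greedy b m.+1 <= ~` el m)%O.
    by rewrite /=; case: ifP => _; [right|left]; exact: leIr.
  by case=> H; [left|right]; exists m.+1.
exists U; first by move=> c; rewrite UE.
by rewrite UE; split=> [|c [n /notI]//]; exists 0.
Qed.

End Greedy.

Lemma stone_basicI b c :
  stone_basic (b `&` c)%O = stone_basic b `&` stone_basic c.
Proof. by apply/seteqP; split=> U /stoneI. Qed.

Lemma stone_basicC b : stone_basic (~` b)%O = ~` stone_basic b.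
Proof. by apply/seteqP; split=> U /stoneC. Qed.

Lemma stone_basic_open b : open (stone_basic b).
Proof. by move=> U Ub; exists b. Qed.

Lemma stone_nbhsP U (A : set (stone B)) :
  nbhs U A <-> exists2 b, stone_set U b & stone_basic b `<=` A.
Proof.
rewrite nbhsE; split=> [[N [oN NU] NA]|[b Ub bA]].
  by have [b Ub bN] := oN U NU; exists b => //; exact: subset_trans NA.
by exists (stone_basic b) => //; split=> //; exact: stone_basic_open.
Qed.

Section CountableAlgebra.
Hypothesis cB : exists el : nat -> B, forall b, exists n, el n = b.

(** If no finite part of [P] joins to [\top], the ideal [J] generated by [P] is proper, and the
    greedy construction gives an ultrafilter avoiding [J], hence covered by no element of [P]. *)
Lemma stone_compact (P : set B) :
  (forall U, exists2 b, P b & stone_set U b) ->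
  exists2 s, (forall b, b \in s -> P b) & joins s = \top%O.
Proof.
have [el el_surj] := cB; move=> covP; apply: contrapT => nS.
pose J b := exists2 s, (forall c, c \in s -> P c) & (b <= joins s)%O.
have [| | | |U _ [_ UI]] := @greedy_stone el (fun b =>
  `[< J b >]) el_surj _ _ _ \top%O.
- by apply/asboolP; exists [::] => //; exact: le0x.
- by move=> b c bc /asboolP[s sP cs]; apply/asboolP; exists s => //;
  exact: le_trans cs.
- move=> b c /asboolP[s sP bs] /asboolP[t tP ct]; apply/asboolP;
  exists (s ++ t).
    by move=> a; rewrite mem_cat => /orP[/sP|/tP].
  have sub r : {subset r <= s ++ t} -> (joins r <= joins (s ++ t))%O.
    by move=> rst; apply: joins_le => a /rst/le_joins.
  rewrite leUx (le_trans bs) ?(le_trans ct)//; apply: sub => a.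
    by rewrite mem_cat => ->; rewrite orbT.
  by rewrite mem_cat => ->.
- apply/asboolPn => -[s sP s1]; apply: nS; exists s => //.
  by apply/eqP; rewrite -le1x.
- have [b Pb /UI/asboolPn] := covP U; apply.
  exists [:: b] => [c|]; first by rewrite inE => /eqP->.
  by rewrite /= joinx0.
Qed.

(** Otherwise the meet of [b] with the complement of [c] is nonzero and lies in some ultrafilter. *)
Lemma stone_basic_le b c : stone_basic b `<=` stone_basic c -> (b <= c)%O.
Proof.
have [el el_surj] := cB; move=> bc; rewrite -[c]complK -disj_leC.
apply: contrapT => /negP bc0.
have [| | |U _ [/stoneI[Ub /stoneC]]] :=
  @greedy_stone el (pred1 \bot%O) el_surj _ _ _ _ bc0.
- exact: eqxx.
- by move=> x y xy /eqP y0; rewrite inE -lex0 -y0.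
- by move=> x y /eqP-> /eqP->; rewrite inE joinx0.
by move=> nUc _; exact/nUc/bc.
Qed.

Lemma stone_basic_inj : injective (@stone_basic d B).
Proof.
by move=> b c bc; apply/eqP; rewrite eq_le !stone_basic_le// bc.
Qed.

(** The basic sets contained in [K] or in its complement cover the space; in a finite subcover,
    those inside [K] join to the required element. *)
Lemma stone_clopen (K : set (stone B)) :
  open K -> open (~` K) -> exists b, K = stone_basic b.
Proof.
move=> oK oCK.
have [U|s sP s1] := @stone_compact
    [set b | stone_basic b `<=` K \/ stone_basic b `<=` ~` K].
  have [/oK|/oCK] := pselect (K U); case=> b Ub bK; exists b => //;
    by [left|right].
exists (joins [seq b <- s | `[< stone_basic b `<=` K >]]); apply/seteqP;
  split=> U.
  move=> KU; apply/joinsP; have := stoneT U; rewrite -s1 => /joinsP[b bs Ub].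
  exists b => //; rewrite mem_filter bs andbT; apply/asboolP.
  by have [//|/(_ _ Ub)] := sP _ bs.
by move=> /joinsP[b]; rewrite mem_filter => /andP[/asboolP bK _] /bK.
Qed.

End CountableAlgebra.

End Ultrafilters.

Section StoneDuality.
Context {dA dB : Order.disp_t}.
Context {A : ctbDistrLatticeType dA} {B : ctbDistrLatticeType dB}.

Lemma boolean_isomorphism_inv (f : A -> B) (g : B -> A) :
  cancel f g -> cancel g f -> boolean_isomorphism f -> boolean_isomorphism g.
Proof.
move=> fK gK [_ [f0 f1] fI fU fC]; split.
- by exists f.
- by split; [rewrite -(fK \bot%O) f0|rewrite -(fK \top%O) f1].
- by move=> x y; rewrite -{1}[x]gK -{1}[y]gK -fI fK.
- by move=> x y; rewrite -{1}[x]gK -{1}[y]gK -fU fK.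
- by move=> x; rewrite -{1}[x]gK -fC fK.
Qed.

Lemma boolean_isomorphism_le (f : A -> B) (x y : A) :
  boolean_isomorphism f -> (x <= y)%O -> (f x <= f y)%O.
Proof. by move=> [_ _ fI _ _] /meet_idPl xy; apply/meet_idPl;
  rewrite -fI xy. Qed.

Lemma stone_pull_exists (f : A -> B) : boolean_isomorphism f ->
  forall V : stone B, exists U : stone A,
    stone_set U = [set a | stone_set V (f a)].
Proof.
move=> iso_f V; have [_ [f0 f1] fI _ fC] := iso_f; apply: stone_exists.
  split=> /=.
  - by rewrite f1; exact: stoneT.
  - by rewrite f0; exact: stone0.
  - by move=> x y Vx Vy; rewrite fI; exact/stoneI.
  - by move=> x y Vx /(boolean_isomorphism_le iso_f)/stoneS; exact.
by move=> b /=; rewrite fC stoneC; exact: EM.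
Qed.

Definition stone_pull (f : A -> B) (iso_f : boolean_isomorphism f) (V :
  stone B) :
  stone A := projT1 (cid (stone_pull_exists iso_f V)).

Lemma stone_pullE f (iso_f : boolean_isomorphism f) V a :
  stone_set (stone_pull iso_f V) a <-> stone_set V (f a).
Proof. by rewrite /stone_pull; case: cid => U /= ->. Qed.

Lemma stone_pull_continuous f (iso_f : boolean_isomorphism f) :
  continuous (stone_pull iso_f).
Proof.
move=> V O /stone_nbhsP[a Ua aO]; apply/stone_nbhsP; exists (f a).
  exact/stone_pullE.
by move=> W Wfa; apply: aO; exact/stone_pullE.
Qed.

End StoneDuality.

Lemma stone_pull_homeomorphism dA dB (A : ctbDistrLatticeType dA)
    (B : ctbDistrLatticeType dB) (f : A -> B) (iso_f : boolean_isomorphism f) :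
  homeomorphism (stone_pull iso_f).
Proof.
have [[g fK gK] _ _ _ _] := iso_f; have iso_g :=
  boolean_isomorphism_inv fK gK iso_f.
split; first exact: stone_pull_continuous.
exists (stone_pull iso_g); split; last exact: stone_pull_continuous.
- by move=> V; apply: stone_ext => b /stone_pullE/stone_pullE; rewrite gK.
- by move=> U; apply: stone_ext => a /stone_pullE/stone_pullE; rewrite fK.
Qed.

Section Homeomorphisms.
Variables X Y Z : topologicalType.

Lemma homeomorphic_sym : homeomorphic X Y -> homeomorphic Y X.
Proof. by move=> [f [cf [g [fK gK cg]]]]; exists g; split=> //; exists f. Qed.

Lemma homeomorphism_comp (f : X -> Y) (g : Y -> Z) :
  homeomorphism f -> homeomorphism g -> homeomorphism (g \o f).
Proof.
move=> [cf [f' [fK f'K cf']]] [cg [g' [gK g'K cg']]]; split.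
  by move=> x; apply: continuous_comp; [exact: cf|exact: cg].
exists (f' \o g'); split; [exact: can_comp|exact: can_comp|].
by move=> z; apply: continuous_comp; [exact: cg'|exact: cf'].
Qed.

End Homeomorphisms.

Lemma homeomorphic_stone (A B : computableBooleanAlgebra) :
  computable_copy A B -> homeomorphic (stone A) (stone B).
Proof.
move=> [f iso_f]; apply: homeomorphic_sym.
by exists (stone_pull iso_f); exact: stone_pull_homeomorphism.
Qed.

(** * Clopen sets of an effectively compact space *)

Lemma computable_iota : computable (iota 0).
Proof.
apply: (@computable_ext _ _ (fun n =>
  nat_rect (fun=> seq nat) [::] (fun i s => s ++ [:: i]) n)).
  apply: (@computable_natrec _ _ (fun=> [::]) (fun _ i s => s ++ [:: i]));
    try by cmp.
  by apply: computable_cat; cmp.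
by elim=> // n ih; rewrite [LHS]/= ih -addn1 iotaD.
Qed.

(* Numbers outside of the universe are sent to [\top]. *)
Definition ba_decode (A : computableBooleanAlgebra) (n : nat) : A :=
  if pselect (exists a, ba_code a = n) is left H then projT1 (cid H) else
    \top%O.

Lemma ba_codeK (A : computableBooleanAlgebra) :
  cancel (@ba_code A) (@ba_decode A).
Proof.
move=> a; rewrite /ba_decode; case: pselect => [H|[]]; last by exists a.
by case: cid => b /= /ba_code_inj.
Qed.

Lemma ba_countable (A : computableBooleanAlgebra) :
  exists el : nat -> A, forall a, exists n, el n = a.
Proof. by exists (@ba_decode A) => a; exists (ba_code a); rewrite ba_codeK. Qed.

Section CoveringBalls.
Context {R : realType} (X : computablePolishSpace R).

Definition covers (s : seq ball_index) : Prop :=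
  forall x : X, exists2 u, u \in s & basic_ball X u x.

(* The name [c] stands for the union of the balls in [c.1]; the balls in [c.2]
   cover exactly the complement. *)
Definition clopen_code (c : seq ball_index * seq ball_index) : Prop :=
  covers (c.1 ++ c.2) /\
  (forall u, u \in c.1 -> forall v, v \in c.2 -> formally_disjoint X u v).

Definition region (c : seq ball_index * seq ball_index) : set X :=
  [set x | exists2 u, u \in c.1 & basic_ball X u x].

Lemma regionCP c x : clopen_code c ->
  ~ region c x <-> exists2 v, v \in c.2 & basic_ball X v x.
Proof.
move=> [cov disj]; split=> [nx|[v vc vx] [u uc ux]].
  have [u] := cov x; rewrite mem_cat => /orP[uc ux|uc ux]; last by exists u.
  by exfalso; apply: nx; exists u.
exact: formally_disjointP (disj _ uc _ vc) ux vx.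
Qed.

Lemma region_sub c c' : clopen_code c -> clopen_code c' ->
  region c `<=` region c' <-> covers (c'.1 ++ c.2).
Proof.
move=> cc cc'; split=> [sub x|cov x cx].
  have [/sub[u uc ux]|/(regionCP _ cc)[u uc ux]] := pselect (region c x);
    by exists u; rewrite ?mem_cat ?uc ?orbT.
have [u] := cov x; rewrite mem_cat => /orP[uc ux|uc ux]; first by exists u.
by exfalso; apply: (regionCP x cc).2 cx; exists u.
Qed.

Lemma basic_ball_open u : open (basic_ball X u).
Proof.
rewrite openE => x; rewrite /basic_ball /= => ux.
apply/metricType_numDomainType.nbhs_mdistP.
exists (u.2.1.+1%:R / u.2.2.+1%:R - mdist (cps_point X u.1) x)%R => /=.
  by rewrite subr_gt0.
move=> y /= xy; apply: le_lt_trans (metric_triangle _ x _) _.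
by rewrite -ltrBrDl.
Qed.

Lemma region_open c : open (region c).
Proof.
rewrite openE => x [u uc ux].
apply: filterS (open_nbhs_nbhs (conj (@basic_ball_open u) ux)) => y uy.
by exists u.
Qed.

Lemma region_open_compl c : clopen_code c -> open (~` region c).
Proof.
move=> cc; rewrite openE => x /(regionCP x cc)[v vc vx].
apply: filterS (open_nbhs_nbhs (conj (@basic_ball_open v) vx)) => y vy.
by apply/(regionCP y cc); exists v.
Qed.

Lemma nbhs_small_ball (x : X) (O : set X) : nbhs x O -> exists2 u,
  basic_ball X u x &
  [set y | mdist (cps_point X u.1) y < 3 * radius u :> R]%R `<=` O.
Proof.
move=> /metricType_numDomainType.nbhs_mdistP[e /= e0 eO].
(* A quarter of [e]: [x] is within [r] of the chosen center and the enlarged ball extends [3 * r]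
   from it. The radius [r] is [2^-b], written as [1 / (2 ^ b)]. *)
have [|b] := @exp2V_lt R (e / 4)%R; first by rewrite divr_gt0.
pose r : R := (1%:R / (2 ^ b).-1.+1%:R)%R.
have -> : (2^-1 ^+ b = r)%R.
  by rewrite /r prednK ?expn_gt0// natrX exprVn mul1r.
move=> re; have r0 : (0 < r)%R by rewrite divr_gt0.
have [y0 [/= xi [i _ iy]]] : [set y | mdist x y < r]%R `&` range (cps_point X)
  !=set0.
  have := @cps_dense R X [set y | mdist x y < r]%R; apply.
    by exists x; rewrite /= mdistxx.
  rewrite openE => y /= xy; apply/metricType_numDomainType.nbhs_mdistP.
  exists (r - mdist x y)%R => /=; first by rewrite subr_gt0.
  move=> z /= yz; apply: le_lt_trans (metric_triangle _ y _) _.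
  by rewrite -ltrBrDl.
rewrite -{}iy in xi.
exists (i, (0, (2 ^ b).-1)); first by rewrite /basic_ball /= metric_sym.
move=> y; rewrite /radius /= -/r => iy; apply: eO => /=.
apply: le_lt_trans (metric_triangle _ (cps_point X i) _) _.
by lra.
Qed.

End CoveringBalls.
Arguments region {R} X c.

Section ClopenAlgebra.
Context {R : realType} (X : computablePolishSpace R).
Context (B : computableBooleanAlgebra) (h : X -> stone B).
Hypothesis cX : effectively_compact X.
Hypothesis hh : homeomorphism h.

Lemma semidecidable_covers : semidecidable (covers X).
Proof.
apply: (semidecidable_ext (ce_semidecidable cX)) => s /=; split=> [sT x|cov].
  have : (\bigcup_(u in [set` s]) basic_ball X u) x by rewrite sT.
  by case=> u us ux; exists u.
by apply/seteqP; split=> // x _; have [u us ux] := cov x; exists u.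
Qed.

Lemma semidecidable_clopen_code : semidecidable (clopen_code X).
Proof.
apply: semidecidable_and.
  apply: (semidecidable_comp _ semidecidable_covers).
  by apply: computable_cat; cmp.
apply: semidecidable_all; last by cmp.
apply: semidecidable_all; last by cmp.
apply: (@semidecidable_comp _ _ _ (fun z => (z.1.2, z.2)) _
  (semidecidable_formally_disjoint X)).
by cmp.
Qed.

Lemma homeomorphism_basic (x : X) (O : set X) : nbhs x O ->
  exists2 b, stone_set (h x) b & h @^-1` stone_basic b `<=` O.
Proof.
move=> xO; have [_ [g [hK gK cg]]] := hh.
have : nbhs (h x) (g @^-1` O) by apply: cg; rewrite hK.
move=> /stone_nbhsP[b hxb bO]; exists b => // y /bO.
by rewrite /preimage /= hK.
Qed.

Lemma preimage_basic_open b : open (h @^-1` stone_basic b).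
Proof.
by apply: open_comp; [move=> x _; exact: hh.1|exact: stone_basic_open].
Qed.

Lemma preimage_basicC b : ~` (h @^-1` stone_basic b) = h @^-1` stone_basic (~`
  b)%O.
Proof. by rewrite stone_basicC preimage_setC. Qed.

Lemma clopen_basic (K : set X) :
  open K -> open (~` K) -> exists b, K = h @^-1` stone_basic b.
Proof.
move=> oK oCK; have [_ [g [hK gK cg]]] := hh.
have [||b bE] := @stone_clopen _ B (ba_countable B) (g @^-1` K).
- by apply: open_comp => // U _; exact: cg.
- by rewrite preimage_setC; apply: open_comp => // U _; exact: cg.
exists b; rewrite -bE; apply/seteqP; split=> x; by rewrite /preimage /= hK.
Qed.

(** [effectively_compact] enumerates the finite covers but does not extract them from infinite ones.
    Finite subcovers come from compactness of [stone B], by refining the balls to preimages of basic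
    sets. *)
Lemma ball_compact (P : set ball_index) :
  (forall x : X, exists2 u, P u & basic_ball X u x) ->
  exists2 s, (forall u, u \in s -> P u) & covers X s.
Proof.
move=> covP; have [_ [g [hK gK cg]]] := hh.
have [U|l lP l1] := @stone_compact _ B (ba_countable B)
    [set b | exists2 u, P u & h @^-1` stone_basic b `<=` basic_ball X u].
  have [u Pu uU] := covP (g U).
  have := homeomorphism_basic (open_nbhs_nbhs (conj (@basic_ball_open R X u)
    uU)).
  by rewrite gK => -[b Ub bu]; exists b => //; exists u.
have [s sP sl] : exists2 s : seq ball_index, (forall u, u \in s -> P u) &
    forall b, b \in l -> exists2 u, u \in s & h @^-1` stone_basic b `<=`
      basic_ball X u.
  elim: l lP {l1} => [|b l ih] lP; first by exists [::].
  have [|s sP sl] := ih; first by move=> c cl; apply: lP; rewrite inE cl orbT.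
  have [u Pu bu] := lP b (mem_head _ _).
  exists (u :: s) => [v|c]; first by rewrite inE => /orP[/eqP->|/sP].
  rewrite inE => /orP[/eqP->|/sl[v vs cv]]; first by exists u;
    rewrite ?mem_head.
  by exists v; rewrite // inE vs orbT.
exists s => // x; have := stoneT (h x); rewrite -l1 => /joinsP[b bl hxb].
by have [u us bu] := sl b bl; exists u => //; exact: bu.
Qed.

(* Balls of thrice the radius contained in [K], resp. in its complement,
   have centers further apart than the sum of the radii. *)
Lemma clopen_code_exists (K : set X) : open K -> open (~` K) ->
  exists2 c, clopen_code X c & region X c = K.
Proof.
move=> oK oCK.
pose big u := [set y | mdist (cps_point X u.1) y < 3 * radius u :> R]%R.
have big_center u : big u (cps_point X u.1).
  by rewrite /big /= mdistxx mulr_gt0// radius_gt0.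
have [x|s sP sT] := @ball_compact [set u | big u `<=` K \/ big u `<=` ~` K].
  have [Kx|Kx] := pselect (K x).
    by have [u ux uK] := nbhs_small_ball (open_nbhs_nbhs (conj oK Kx));
      exists u => //; left.
  by have [u ux uK] := nbhs_small_ball (open_nbhs_nbhs (conj oCK Kx));
    exists u => //; right.
have ball_big u : basic_ball X u `<=` big u.
  move=> y; rewrite /basic_ball /big /= -/(radius u) => /lt_trans; apply.
  by have := @radius_gt0 R u; lra.
pose c := ([seq u <- s | `[< big u `<=` K >]],
  [seq u <- s | ~~ `[< big u `<=` K >]]).
have outP u : u \in c.2 -> big u `<=` ~` K.
  by rewrite mem_filter => /andP[/asboolPn nuK /sP[]].
have inP u : u \in c.1 -> big u `<=` K.
  by rewrite mem_filter => /andP[/asboolP].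
have cc : clopen_code X c.
  split=> [x|u /inP uK v /outP vK].
    have [u us ux] := sT x; exists u => //;
      rewrite mem_cat !mem_filter us !andbT.
    by case: asboolP.
  have /negP : ~ big u (cps_point X v.1) by move=> /uK; exact: vK.
  have /negP : ~ big v (cps_point X u.1) by move=> /vK; apply; exact: uK.
  (* The centers are at least thrice each radius apart, hence at least 3/2 of the sum of the radii,
     which strictly exceeds that sum. *)
  rewrite /big /= -!leNgt (metric_sym (cps_point X v.1)) /formally_disjoint.
  by have := @radius_gt0 R u; have := @radius_gt0 R v; lra.
exists c => //; apply/seteqP; split=> x; first by case=> u /inP uK /ball_big/uK.
move=> Kx; apply: contrapT => /(regionCP x cc)[v /outP vK /ball_big/vK].
exact.
Qed.

Lemma clopen_code_enum : exists2 e : nat -> seq ball_index * seq ball_index,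
  computable e & range e = clopen_code X.
Proof.
apply: semidecidable_enum.
- by apply: effective_pair; do !apply: effective_seq;
  do !apply: effective_pair; exact: effective_nat.
- exact: semidecidable_clopen_code.
- have [||c cc _] := @clopen_code_exists setT; [exact: openT| |by exists c].
  by rewrite setCT; exact: open0.
Qed.

End ClopenAlgebra.

(** * Coding the algebra by the least names of clopen sets *)

Section RecodedAlgebra.
Context {R : realType} (X : computablePolishSpace R).
Context (B : computableBooleanAlgebra) (h : X -> stone B).
Hypothesis cX : effectively_compact X.
Hypothesis hh : homeomorphism h.
Variable e : nat -> seq ball_index * seq ball_index.
Hypothesis ce : computable e.
Hypothesis re : range e = clopen_code X.

Let reg n : set X := region X (e n).
Let pre (b : B) : set X := h @^-1` stone_basic b.

Lemma clopen_code_enumP n : clopen_code X (e n).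
Proof. by rewrite -re; exists n. Qed.

Lemma reg_pre n : exists b, reg n = pre b.
Proof.
apply: (clopen_basic hh); first exact: region_open.
exact/region_open_compl/clopen_code_enumP.
Qed.

Lemma pre_reg b : exists n, `[< reg n = pre b >].
Proof.
have [||c] := @clopen_code_exists R X B h hh (pre b).
- exact: preimage_basic_open.
- by rewrite preimage_basicC; exact: preimage_basic_open.
by rewrite -re => -[n _ <-] nb; exists n; apply/asboolP.
Qed.

Lemma pre_inj : injective pre.
Proof.
move=> b c bc; apply: (stone_basic_inj (ba_countable B)).
have [_ [g [_ gK _]]] := hh; apply/funext => U.
by rewrite -(gK U); exact: (congr1 (@^~ (g U)) bc).
Qed.

(* [recode] makes [B] a copy of the algebra of clopen subsets of [X]: the code
   of [b] is the least index of a name of the clopen set dual to [b]. *)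
Definition recode (b : B) : nat := ex_minn (pre_reg b).

Lemma recodeP b : reg (recode b) = pre b.
Proof. by rewrite /recode; case: ex_minnP => n /asboolP. Qed.

Lemma recode_min b n : reg n = pre b -> recode b <= n.
Proof.
by move=> nb; rewrite /recode; case: ex_minnP => m _; apply; apply/asboolP.
Qed.

Lemma recode_inj : injective recode.
Proof. by move=> b c bc; apply: pre_inj; rewrite -!recodeP bc. Qed.

Lemma semidecidable_sub : semidecidable (fun z : nat * nat =>
  reg z.1 `<=` reg z.2).
Proof.
apply: (@semidecidable_ext _ (fun z => covers X ((e z.2).1 ++ (e z.1).2))).
  apply: (semidecidable_comp _ (semidecidable_covers cX)).
  by apply: computable_cat; cmp.
by move=> z; symmetry; apply: region_sub; exact: clopen_code_enumP.
Qed.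

(** A point of the difference lies in a ball of the first list of [n] and in one of the second list
    of [m]. These balls meet in a nonempty open set, so by density they share a special point, and
    membership of special points in balls is semidecidable. *)
Lemma semidecidable_nsub :
  semidecidable (fun z : nat * nat => ~ (reg z.1 `<=` reg z.2)).
Proof.
pose Q (z : nat * nat) (w : nat * (ball_index * ball_index)) :=
  (w.2.1 \in (e z.1).1 /\ w.2.2 \in (e z.2).2) /\
  (basic_ball X w.2.1 (cps_point X w.1) /\ basic_ball X w.2.2 (cps_point X
    w.1)).
apply: (@semidecidable_ext _ (fun z => exists w, Q z w)).
  apply: semidecidable_exists.
    by do !apply: effective_pair; exact: effective_nat.
  apply: semidecidable_and; apply: semidecidable_and.
  - by apply: decidable_semidecidable; apply: computable_mem; cmp.
  - by apply: decidable_semidecidable; apply: computable_mem; cmp.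
  - apply: (@semidecidable_comp _ _ _ (fun w => (w.2.1, w.2.2.1)) _
      (semidecidable_ball X)).
    by cmp.
  - apply: (@semidecidable_comp _ _ _ (fun w => (w.2.1, w.2.2.2)) _
      (semidecidable_ball X)).
    by cmp.
move=> [n m]; rewrite /Q /=; split.
  move=> [[k [u v]] /= [[un vm] [ku kv]]] sub.
  have /sub : reg n (cps_point X k) by exists u.
  by apply/(regionCP _ (clopen_code_enumP m)); exists v.
move=> /existsNP[x /not_implyP[[u un ux]]].
move=> /(regionCP _ (clopen_code_enumP m))[v vm vx].
have [] := @cps_dense R X (basic_ball X u `&` basic_ball X v).
- by exists x.
- by apply: openI; exact: basic_ball_open.
by move=> y [[yu yv] [k _ ky]]; exists (k, (u, v)); rewrite /= ky.
Qed.

Let sub n m : bool := `[< reg n `<=` reg m >].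

Lemma computable_sub : computable (fun z : nat * nat => sub z.1 z.2).
Proof.
apply: (@computable_decide _ (fun z : nat * nat => reg z.1 `<=` reg z.2)).
- by apply: effective_pair; exact: effective_nat.
- exact: semidecidable_sub.
- exact: semidecidable_nsub.
Qed.

(** Equality of regions is tested as mutual inclusion, which is decidable, so the least name can be
    recognized without reference to [B]. *)
Definition canonical_index n : bool :=
  all (fun m => ~~ (sub m n && sub n m)) (iota 0 n).

Lemma computable_canonical_index : computable canonical_index.
Proof.
have cs := computable_sub; have ci := computable_iota.
apply: (@computable_all _ _ (fun n m => ~~ (sub m n && sub n m))); last by cmp.
by apply: computable_neg; apply: computable_and; cmp.
Qed.

Lemma canonical_indexP n : canonical_index n <-> range recode n.
Proof.
split=> [/allP can_n|[b _ <-]]; last first.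
  apply/allP => m; rewrite mem_iota /= add0n => mb.
  apply/negP => /andP[/asboolP mn /asboolP nm].
  move: mb; rewrite ltnNge => /negP; apply; apply: recode_min.
  by rewrite -recodeP; apply/seteqP.
have [b nb] := reg_pre n; exists b => //; apply/eqP;
  rewrite eqn_leq recode_min//=.
rewrite leqNgt; apply/negP => bn; have := can_n (recode b).
rewrite mem_iota /= add0n => /(_ bn) /negP; apply.
by apply/andP; split; apply/asboolP; rewrite recodeP nb.
Qed.

Lemma recode_range : computable_set (range recode).
Proof.
have [g rg cg] := computable_canonical_index.
have [c rc cE] := rec1_tuple rg; exists c => // n.
rewrite cE -[n in g n]/(pickle n) -cg.
by rewrite -[LHS]/(canonical_index n : nat); congr nat_of_bool;
  apply/idP/asboolP => /canonical_indexP.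
Qed.

(** Two names are complementary exactly when their first lists together cover the space and so do
    their second lists. Both are semidecidable, and among canonical indices the solution is
    unique. *)
Lemma recode_compl_subproof : exists2 f : nat -> nat, computable f &
  forall b, recode (~` b)%O = f (recode b).
Proof.
pose Q n k := canonical_index k /\
  (covers X ((e k).2 ++ (e n).2) /\ covers X ((e k).1 ++ (e n).1)).
have QP n k : Q n k <-> canonical_index k /\ reg k = ~` reg n.
  have [ck cn] := (clopen_code_enumP k, clopen_code_enumP n).
  split=> -[can_k]; last first.
    move=> kn; split=> //; split=> x.
      have [kx|/(regionCP x ck)[v vk vx]] := pselect (reg k x).
        move: kx; rewrite kn => /(regionCP x cn)[v vn vx].
        by exists v; rewrite // mem_cat vn orbT.
      by exists v; rewrite // mem_cat vk.
    have [[u uk ux]|] := pselect (reg k x); first by exists u;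
      rewrite // mem_cat uk.
    by rewrite kn /setC /= => /contrapT[u un ux]; exists u;
      rewrite // mem_cat un orbT.
  move=> [cov2 cov1]; split=> //; apply/seteqP; split=> x.
    move=> kx; have [u] := cov2 x; rewrite mem_cat => /orP[uk|un] ux.
      by exfalso; apply: ((regionCP x ck).2 _ kx); exists u.
    by apply/(regionCP x cn); exists u.
  move=> nx; have [u] := cov1 x; rewrite mem_cat => /orP[uk|un] ux;
    first by exists u.
  by exfalso; apply: nx; exists u.
have [| | | |f cf fQ] := @computable_choice nat nat Q.
- exact: effective_nat.
- exact: effective_nat.
- have cc := computable_canonical_index.
  apply: semidecidable_and; first by apply: decidable_semidecidable; cmp.
  apply: semidecidable_and; apply: (semidecidable_comp _ (semidecidable_covers
    cX));
    by apply: computable_cat; cmp.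
- move=> n; have [b nb] := reg_pre n; exists (recode (~` b)%O); apply/QP.
  split; first by apply/canonical_indexP; exists (~` b)%O.
  by rewrite recodeP nb; rewrite /pre preimage_basicC.
exists f => // b; have /QP[/canonical_indexP[c _ cf'] fb] := fQ (recode b).
rewrite -cf'; congr recode; apply: pre_inj.
by rewrite -(recodeP c) cf' fb recodeP /pre preimage_basicC.
Qed.

(** The meet is the canonical [k] that is included in both regions and covers the space together
    with both complements. *)
Lemma recode_meet_subproof : exists2 f : nat * nat -> nat, computable f &
  forall b c, recode (b `&` c)%O = f (recode b, recode c).
Proof.
pose Q (z : nat * nat) k := (canonical_index k /\
  covers X ((e k).1 ++ ((e z.1).2 ++ (e z.2).2))) /\
  (reg k `<=` reg z.1 /\ reg k `<=` reg z.2).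
have QP z k : Q z k <-> canonical_index k /\ reg k = reg z.1 `&` reg z.2.
  have [[ck c1] c2] :=
    (clopen_code_enumP k, clopen_code_enumP z.1, clopen_code_enumP z.2).
  split=> [[[can_k cov] [k1 k2]]|[can_k kE]]; split=> //.
  - apply/seteqP; split=> x; first by move=> kx; split; [exact: k1|exact: k2].
    move=> [x1 x2]; have [u] := cov x; rewrite !mem_cat => /or3P[] uc ux;
      first by exists u.
      by exfalso; apply: (regionCP x c1).2 x1; exists u.
    by exfalso; apply: (regionCP x c2).2 x2; exists u.
  - split=> // x.
    have [x1|/(regionCP x c1)[u uc ux]] := pselect (reg z.1 x); last first.
      by exists u; rewrite // !mem_cat uc orbT.
    have [x2|/(regionCP x c2)[u uc ux]] := pselect (reg z.2 x); last first.
      by exists u; rewrite // !mem_cat uc !orbT.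
    have : reg k x by rewrite kE.
    by case=> u uc ux; exists u; rewrite // mem_cat uc.
  - by rewrite kE; split; [exact: subIsetl|exact: subIsetr].
have [| | | |f cf fQ] := @computable_choice (nat * nat)%type nat Q.
- by apply: effective_pair; exact: effective_nat.
- exact: effective_nat.
- have cc := computable_canonical_index.
  apply: semidecidable_and; apply: semidecidable_and.
  + by apply: decidable_semidecidable; cmp.
  + apply: (semidecidable_comp _ (semidecidable_covers cX)).
    by do !(apply: computable_cat); cmp.
  + by apply: (@semidecidable_comp _ _ _ (fun w => (w.2,
    w.1.1)) _ semidecidable_sub); cmp.
  + by apply: (@semidecidable_comp _ _ _ (fun w => (w.2,
    w.1.2)) _ semidecidable_sub); cmp.
- move=> [n m]; have [b nb] := reg_pre n; have [c mc] := reg_pre m.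
  exists (recode (b `&` c)%O); apply/QP.
  split; first by apply/canonical_indexP; exists (b `&` c)%O.
  by rewrite recodeP /= nb mc /pre stone_basicI preimage_setI.
exists f => // b c; have /QP[/canonical_indexP[a _ af] fb] := fQ (recode b,
  recode c).
rewrite -af; congr recode; apply: pre_inj.
by rewrite -(recodeP a) af fb /= !recodeP /pre stone_basicI preimage_setI.
Qed.

Lemma recode_compl : exists2 f : 1.-tuple nat -> nat, recursive f &
  forall b, recode (~` b)%O = f [tuple recode b].
Proof.
have [f /computable_rec1/rec1_tuple[c rc cE] fE] := recode_compl_subproof.
by exists c => // b; rewrite cE fE.
Qed.

Lemma recode_meet : exists2 f : 2.-tuple nat -> nat, recursive f &
  forall b c, recode (b `&` c)%O = f [tuple recode b; recode c].
Proof.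
have [f /computable_rec2/rec2_tuple[k rk kE] fE] := recode_meet_subproof.
by exists k => // b c; rewrite kE fE.
Qed.

Lemma recode_join : exists2 f : 2.-tuple nat -> nat, recursive f &
  forall b c, recode (b `|` c)%O = f [tuple recode b; recode c].
Proof.
have [f cf fE] := recode_meet_subproof; have [k ck kE] := recode_compl_subproof.
have : computable (fun z => k (f (k z.1, k z.2))) by cmp.
move=> /computable_rec2/rec2_tuple[g rg gE]; exists g => // b c.
by rewrite gE /= -!kE -fE -kE complI !complK.
Qed.

(** The underlying algebra is still [B]; only the coding changes, so the identity is an isomorphism
    with [B]. *)
Definition recoded : computableBooleanAlgebra :=
  ComputableBooleanAlgebra recode_inj recode_range recode_meet recode_join
    recode_compl.

Lemma recoded_copy : computable_copy recoded B.
Proof. by exists id; split=> //; exists id. Qed.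

End RecodedAlgebra.

Lemma homeomorphism_inv (X Y : topologicalType) (f : X -> Y) :
  homeomorphism f ->
  exists g, [/\ homeomorphism g, cancel f g & cancel g f].
Proof. by move=> [cf [g [fK gK cg]]]; exists g; split=> //; split=> //;
  exists f. Qed.

(** * The homeomorphism dual to a computable isomorphism *)

Section CategoricalToEffective.
Context {R : realType} (B : computableBooleanAlgebra).
Context (X Y : computablePolishSpace R) (hX : X -> stone B) (hY : Y -> stone B).
Hypotheses (cX : effectively_compact X) (cY : effectively_compact Y).
Hypotheses (hhX : homeomorphism hX) (hhY : homeomorphism hY).
Variables eX eY : nat -> seq ball_index * seq ball_index.
Hypotheses (ceX : computable eX) (ceY : computable eY).
Hypotheses (reX : range eX = clopen_code X) (reY : range eY = clopen_code Y).

Let A := recoded cX hhX ceX reX.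
Let A' := recoded cY hhY ceY reY.

Lemma effectively_continuous_homeomorphism : computably_isomorphic A A' ->
  exists f : X -> Y, homeomorphism f /\ effectively_continuous f.
Proof.
move=> [p [iso_p [c /rec1P rc pE]]].
have [q [hq pK qK]] := homeomorphism_inv (stone_pull_homeomorphism iso_p).
have [gY [hgY hYK gYK]] := homeomorphism_inv hhY.
pose f := gY \o (q \o hX) : X -> Y.
exists f; split.
  by apply: homeomorphism_comp hgY; exact: homeomorphism_comp hq.
(* [f] is dual to [p]: it carries the clopen set of [b] onto that of [p b]. *)
have fP b x : stone_set (hY (f x)) (p b) <-> stone_set (hX x) b.
  by rewrite /f /= gYK -(stone_pullE iso_p) qK.
move: rc pE; set g := fun n => c [tuple n]; move=> rg pE.
have [p' _ pK'] : exists2 p' : B -> B, cancel p p' & cancel p' p.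
  by have [[p' ? ?] _ _ _ _] := iso_p; exists p'.
have recE b : region Y (eY (g (recode hhX reX b))) = hY @^-1` stone_basic (p b).
  by rewrite -[g _](pE b); exact: recodeP.
(* A pair [(D, E)] is listed when [D] is a ball of a canonical name [n] and the image region, named
   by [g n], is inside [E]. The inclusion is expressed by a cover: [E] together with the balls for
   the complement of that region. *)
pose F (w : ball_index * ball_index) := exists n, (canonical_index X eX n /\
  w.1 \in (eX n).1) /\ covers Y (w.2 :: (eY (g n)).2).
exists F; split.
- apply: semidecidable_ce.
    by do !apply: effective_pair; exact: effective_nat.
  apply: (@semidecidable_exists _ _ (fun w n => (canonical_index X eX n /\
    w.1 \in (eX n).1) /\ covers Y (w.2 :: (eY (g n)).2)) effective_nat).
  apply: semidecidable_and; [apply: semidecidable_and|].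
  + apply: decidable_semidecidable.
    by have cc := computable_canonical_index cX ceX reX; cmp.
  + by apply: decidable_semidecidable; apply: computable_mem; cmp.
  + by apply: (semidecidable_comp _ (semidecidable_covers cY)); cmp.
- move=> U V [n [[/= /(canonical_indexP hhX reX)[b _ <-] Un] cov]] _ [x xU <-].
  have xb : region X (eX (recode hhX reX b)) x by exists U.
  have : region Y (eY (g (recode hhX reX b))) (f x).
    by rewrite recE; apply/fP; rewrite (recodeP hhX reX) in xb.
  have [v] := cov (f x); rewrite inE => /orP[/eqP->//|vn vf] reg_f; exfalso.
  by apply: (regionCP _ (clopen_code_enumP reY _)).2 reg_f; exists v.
- move=> x E Ex.
  have [c0 fc c0E] := homeomorphism_basic hhY (open_nbhs_nbhs (conj
    (@basic_ball_open R Y E) Ex)).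
  pose b := p' c0; have pb : p b = c0 by exact: pK'.
  have : region X (eX (recode hhX reX b)) x.
    by rewrite (recodeP hhX reX); apply/fP; rewrite pb.
  case=> D Dn xD; exists D => //; exists (recode hhX reX b); split.
    by split=> //; apply/(canonical_indexP hhX reX); exists b.
  move=> y.
  have [|/(regionCP _ (clopen_code_enumP reY _))[v vn vy]] :=
    pselect (region Y (eY (g (recode hhX reX b))) y).
    by rewrite recE pb => /c0E; exists E; rewrite ?mem_head.
  by exists v; rewrite // inE vn orbT.
Qed.

End CategoricalToEffective.

Lemma categorical_effective (R : realType) (B : computableBooleanAlgebra) :
  computably_categorical B -> effectively_categorical R (stone B).
Proof.
move=> catB X Y cX cY [hX hhX] [hY hhY].
have [eX ceX reX] := clopen_code_enum cX hhX.
have [eY ceY reY] := clopen_code_enum cY hhY.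
apply: (effectively_continuous_homeomorphism (cX := cX) (cY := cY) (hhX := hhX)
  (hhY := hhY) (ceX := ceX) (ceY := ceY) (reX := reX) (reY := reY)).
by apply: catB; exact: recoded_copy.
Qed.

(** * The Stone space as an effectively compact space *)

(** Alias on which [ba_code] becomes [pickle], so that [computable] and [semidecidable] apply to
    elements of the algebra. *)
Definition ba_type (A : computableBooleanAlgebra) : Type := A.
HB.instance Definition _ A := Choice.copy (ba_type A) (ba_sort A).
HB.instance Definition _ A :=
  Choice_isCountable.Build (ba_type A) (can_pcan (@ba_codeK A)).

Section ComputableBooleanOperations.
Variable A : computableBooleanAlgebra.
Implicit Types a b : ba_type A.

Definition bmeet a b : ba_type A := ((a : A) `&` (b : A))%O.
Definition bjoin a b : ba_type A := ((a : A) `|` (b : A))%O.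
Definition bcompl a : ba_type A := (~` (a : A))%O.
Definition ble a b : bool := ((a : A) <= (b : A))%O.
Definition bdecode (n : nat) : ba_type A := ba_decode A n.

Lemma computable_bmeet : computable (fun z : ba_type A * ba_type A =>
  bmeet z.1 z.2).
Proof.
have [f /rec2P rf fE] := ba_meet A.
exists (fun n => f [tuple nhd n; nhd (ntl n)]).
  by apply: (recursive_app2 rf); [exact: rec1_nhd|exact:
    (recursive_app1 rec1_nhd rec1_ntl)].
by move=> [x y]; rewrite pickle_pairE nhd_cons ntl_cons nhd_cons; exact: fE.
Qed.

Lemma computable_bjoin : computable (fun z : ba_type A * ba_type A =>
  bjoin z.1 z.2).
Proof.
have [f /rec2P rf fE] := ba_join A.
exists (fun n => f [tuple nhd n; nhd (ntl n)]).
  by apply: (recursive_app2 rf); [exact: rec1_nhd|exact: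
    (recursive_app1 rec1_nhd rec1_ntl)].
by move=> [x y]; rewrite pickle_pairE nhd_cons ntl_cons nhd_cons; exact: fE.
Qed.

Lemma computable_bcompl : computable bcompl.
Proof.
have [f /rec1P rf fE] := ba_compl A.
by exists (fun n => f [tuple n]) => // x; exact: fE.
Qed.

Lemma computable_ble : computable (fun z : ba_type A * ba_type A =>
  ble z.1 z.2).
Proof.
have cm := computable_bmeet.
apply: (@computable_ext _ _ (fun z : ba_type A * ba_type A =>
  bmeet z.1 z.2 == z.1)).
  by apply: computable_eq; cmp.
by move=> [x y]; rewrite /ble leEmeet.
Qed.

(** On codes the decoder is tracked by the identity and elsewhere by the code of [\top]; [ba_range]
    decides between the cases. *)
Lemma computable_bdecode : computable bdecode.
Proof.
have [c rc cE] := ba_range A.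
have /computable_rec1 cc := rec1P rc.
have cp : computable (fun n => c [tuple n] == 1).
  by apply: (computable_eq cc); cmp.
have [g rg gE] : computable (fun n => if c [tuple n] == 1 then n
    else ba_code (\top%O : A)) by cmp.
exists g => // n; rewrite -gE cE /bdecode /ba_decode.
case: asboolP => [[a _ an]|no] /=; case: pselect => [H|nH].
- by case: cid => b /=.
- by case: nH; exists a.
- by case: no; case: H => a an; exists a.
- by [].
Qed.

Lemma effective_ba : effective (ba_type A).
Proof. by exists bdecode; [exact: computable_bdecode|exact: ba_codeK]. Qed.

End ComputableBooleanOperations.

(** * Greedy ultrafilters as special points *)

Section GreedyPoints.
Variable A : computableBooleanAlgebra.
Hypothesis A_nontrivial : (\bot != \top :> A)%O.

(** Replacing [\bot] by [\top] makes every seed nonzero in a nontrivial algebra, while each nonzero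
    element remains a seed. *)
Definition seed (i : nat) : ba_type A :=
  if bdecode A i == (\bot%O : A) then (\top%O : A) else bdecode A i.

Lemma seed_neq0 i : (seed i : A) != \bot%O.
Proof. by rewrite /seed; case: ifPn => // _; rewrite eq_sym. Qed.

Lemma seed_code (b : A) : b != \bot%O -> seed (ba_code b) = b.
Proof. by move=> b0; rewrite /seed /bdecode ba_codeK (negbTE b0). Qed.

Definition approx (i n : nat) : ba_type A :=
  greedy (@ba_decode A) (pred1 \bot%O) (seed i) n.

Lemma point_exists i : exists2 U : stone A,
  (forall c, stone_set U c <-> exists n,
    ble (approx i n) c) & stone_set U (seed i).
Proof.
have [| | | | |U UE [Us _]] := @greedy_stone _ A (@ba_decode A) (pred1 \bot%O)
  _ _ _ _ (seed i).
- by move=> b; exists (ba_code b); rewrite ba_codeK.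
- exact: eqxx.
- by move=> x y xy /eqP y0; rewrite inE -lex0 -y0.
- by move=> x y /eqP-> /eqP->; rewrite inE joinx0.
- exact: seed_neq0.
by exists U.
Qed.

Definition point (i : nat) : stone A := projT1 (cid2 (point_exists i)).

Lemma pointP i c : stone_set (point i) c <-> exists n, ble (approx i n) c.
Proof. by rewrite /point; case: cid2. Qed.

Lemma point_seed i : stone_set (point i) (seed i).
Proof. by rewrite /point; case: cid2. Qed.

Definition bit i n : bool := ble (approx i n.+1) (bdecode A n).

(** Step [n.+1] puts the approximation below the [n]-th element or below its complement, so a single
    comparison settles membership. *)
Lemma bitP i n : stone_set (point i) (bdecode A n) <-> bit i n.
Proof.
split=> [Un|bn]; last by apply/pointP; exists n.+1.
have Ua : stone_set (point i) (approx i n.+1).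
  by apply/pointP; exists n.+1; exact: lexx.
rewrite /bit /ble /approx /=; case: ifPn => [/eqP i0|_]; last exact: leIr.
exfalso; move: Ua; rewrite /approx /= i0 eqxx => /stoneI[_ /stoneC]; exact.
Qed.

Lemma computable_seed : computable seed.
Proof.
have cd := computable_bdecode A.
by apply: computable_if; cmp; apply: computable_eq; cmp.
Qed.

Lemma computable_approx : computable (fun z : nat * nat => approx z.1 z.2).
Proof.
have [cs cd] := (computable_seed, computable_bdecode A).
have [cm cc] := (@computable_bmeet A, @computable_bcompl A).
pose step (_ : nat * nat) (n : nat) (c : ba_type A) : ba_type A :=
  if bmeet c (bdecode A n) == (\bot%O : A) then bmeet c (bcompl (bdecode A n))
  else bmeet c (bdecode A n).
apply: (@computable_ext _ _ (fun z : nat * nat =>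
    nat_rect (fun=> ba_type A) (seed z.1) (step z) z.2)).
  apply: computable_natrec; [by cmp| |by cmp].
  by apply: computable_if; cmp; apply: computable_eq; cmp.
move=> [i n] /=; elim: n => //= n ->.
by rewrite /step /approx /=; case: ifP.
Qed.

Lemma computable_bit : computable (fun z : nat * nat => bit z.1 z.2).
Proof.
have [ca cd] := (computable_approx, computable_bdecode A).
have cl := @computable_ble A.
by rewrite /bit; cmp.
Qed.

End GreedyPoints.

(** Alias that carries the metric with values in [R], while [stone A] keeps the topology generated
    by the basic sets. *)
Definition stone_metric (R : realType) (A : computableBooleanAlgebra) : Type :=
  stone A.

Section StoneMetric.
Context {R : realType} (A : computableBooleanAlgebra).
Implicit Types U V W : stone A.

Definition differ U V n : bool :=
  `[< stone_set U (ba_decode A n) >] != `[< stone_set V (ba_decode A n) >].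

Definition agree U V N : Prop := forall n, n < N -> ~~ differ U V n.

(* Coordinates are indexed by codes; non-codes stand for [\top], on which no two
   ultrafilters differ. *)
Definition sdist U V : R :=
  if pselect (exists n, differ U V n) is left H then (2^-1 ^+ ex_minn H)%R else
    0%R.

Lemma exp2V_gt0 n : (0 < 2^-1 ^+ n :> R)%R.
Proof. by rewrite exprn_gt0// invr_gt0. Qed.

Lemma exp2V_le m n : (2^-1 ^+ m <= 2^-1 ^+ n :> R)%R = (n <= m).
Proof. by rewrite ler_iXn2l// ?invr_gt0// invf_lt1// ltr1n. Qed.

Lemma sdist_le U V N : (sdist U V <= 2^-1 ^+ N)%R <-> agree U V N.
Proof.
rewrite /sdist; case: pselect => [H|nH]; last first.
  split=> _; last exact/ltW/exp2V_gt0.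
  by move=> n _; apply/negP => d; apply: nH; exists n.
case: ex_minnP => m dm m_min; rewrite exp2V_le; split=> [Nm n nN|aN].
  by apply/negP => /m_min; rewrite leqNgt (leq_trans nN Nm).
by rewrite leqNgt; apply/negP => /aN; rewrite dm.
Qed.

Lemma sdist_ge U V n : differ U V n -> (2^-1 ^+ n <= sdist U V)%R.
Proof.
rewrite /sdist => dn; case: pselect => [H|[]]; last by exists n.
by case: ex_minnP => m _ /(_ _ dn); rewrite exp2V_le.
Qed.

Lemma sdist_ge0 U V : (0 <= sdist U V)%R.
Proof. by rewrite /sdist; case: pselect => // H; exact/ltW/exp2V_gt0. Qed.

Lemma differ_sym U V n : differ U V n = differ V U n.
Proof. by rewrite /differ eq_sym. Qed.

Lemma sdistxx U : sdist U U = 0%R.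
Proof.
rewrite /sdist; case: pselect => // H; exfalso.
by case: H => n; rewrite /differ eqxx.
Qed.

Lemma sdist_positivity U V : sdist U V = 0%R -> U = V.
Proof.
move=> UV; apply: stone_ext => b Ub; apply: contrapT => Vb.
have : differ U V (ba_code b).
  by rewrite /differ ba_codeK asboolT// asboolF.
by move=> /sdist_ge; rewrite UV leNgt exp2V_gt0.
Qed.

Lemma sdist_sym U V : sdist U V = sdist V U.
Proof.
rewrite /sdist; case: pselect => [H|nH]; case: pselect => [H'|nH'] //.
- congr (_ ^+ _)%R; case: ex_minnP => m dm m_min; case: ex_minnP => n dn n_min.
  by apply/eqP; rewrite eqn_leq m_min ?n_min// differ_sym.
- by exfalso; apply: nH'; have [n dn] := H; exists n; rewrite differ_sym.
- by exfalso; apply: nH; have [n dn] := H'; exists n; rewrite differ_sym.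
Qed.

(** Where [U] and [W] first differ, [V] differs from one of them, so one summand alone is already
    large enough. *)
Lemma sdist_triangle V U W : (sdist U W <= sdist U V + sdist V W)%R.
Proof.
have UV := sdist_ge0 U V; have VW := sdist_ge0 V W.
rewrite {1}/sdist; case: pselect => [H|_]; last exact: addr_ge0.
case: ex_minnP => n dn _; have : differ U V n \/ differ V W n.
  move: dn; rewrite /differ.
  by do 3 case: `[< _ >] => //=; by [left|right].
case=> /sdist_ge dn'; first by apply: le_trans dn' _; rewrite lerDl.
by apply: le_trans dn' _; rewrite lerDr.
Qed.

(** The distance takes only the values 0 and [2^-n], so a radius matters only through the least [N]
    with [2^-N] below it. *)
Lemma sdist_lt U V N (q : R) : (2^-1 ^+ N < q)%R ->
  (forall n, n < N -> (q <= 2^-1 ^+ n)%R) -> (sdist U V < q)%R <-> agree U V N.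
Proof.
move=> Nq qn; split=> [UVq n nN|/sdist_le/le_lt_trans]; last exact.
by apply/negP => /sdist_ge/(le_trans (qn n nN)); rewrite leNgt UVq.
Qed.

Definition literal U n : A :=
  if `[< stone_set U (ba_decode A n) >] then ba_decode A n else (~` ba_decode A
    n)%O.

Definition literals U N : A :=
  nat_rect (fun=> (A : Type)) \top%O (fun n c => c `&` literal U n)%O N.

Lemma literalP U V n : stone_set V (literal U n) <-> ~~ differ U V n.
Proof.
rewrite /literal /differ; case: asboolP => Un; case: asboolP => Vn //=.
  by split=> // /stoneC.
by split=> // _; exact/stoneC.
Qed.

Lemma literalsP U V N : stone_set V (literals U N) <-> agree U V N.
Proof.
elim: N => [|N ih] /=; first by split=> // _; exact: stoneT.
rewrite stoneI ih literalP; split=> [[aN dN] n|aN].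
  by rewrite ltnS leq_eqVlt => /orP[/eqP->//|]; exact: aN.
by split=> [n nN|]; apply: aN => //; exact: ltnW.
Qed.

End StoneMetric.

HB.instance Definition _ (R : realType) A :=
  Choice.copy (stone_metric R A) (stone A).
HB.instance Definition _ (R : realType) A :=
  isMetric.Build R (stone_metric R A) (@sdistxx R A) (@sdist_positivity R A)
    (@sdist_sym R A) (@sdist_triangle R A).

(** * The Stone space as an effectively compact presentation *)

Section StonePolish.
Context (R : realType) (A : computableBooleanAlgebra).
Local Notation SM := (stone_metric R A).

(** The metric induces the Stone topology: agreement on the first [N] coordinates is membership of
    one conjunction of literals, and the basic set of [b] contains the balls of radius
    [2^-(ba_code b)] around its points. *)
Lemma sm_nbhsP (U : SM) (O : set SM) :
  nbhs U O <-> exists2 b, stone_set U b & [set V : SM | stone_set V b] `<=` O.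
Proof.
split=> [/metricType_numDomainType.nbhs_mdistP[e /= e0 eO]|[b Ub bO]].
  have [N Ne] := exp2V_lt e0; exists (literals U N).
    by apply/literalsP => n _; rewrite /differ eqxx.
  move=> V /literalsP aN; apply: eO => /=.
  by apply: le_lt_trans Ne; exact/sdist_le.
apply/(@metricType_numDomainType.nbhs_mdistP R SM U O).
exists (2^-1 ^+ ba_code b)%R => /=; first exact: exp2V_gt0.
move=> V /= UV; apply: bO => /=; apply: contrapT => nVb.
have /sdist_ge : differ U V (ba_code b) by rewrite /differ ba_codeK asboolT//
  asboolF.
by move=> /(_ R); rewrite leNgt => /negP; exact.
Qed.

Lemma sm_homeomorphism : @homeomorphism SM (stone A) id.
Proof.
split; last exists id; last split=> //.
  by move=> U O /stone_nbhsP; rewrite nbhs_simpl => Ob; apply/sm_nbhsP.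
by move=> U O /sm_nbhsP Ob; rewrite nbhs_simpl; apply/stone_nbhsP.
Qed.

(** A Cauchy filter has a member of points pairwise agreeing with some [U] on [b], so it decides
    every [b]; the elements it accepts form the limit ultrafilter. *)
Lemma sm_complete (F : set_system SM) : ProperFilter F -> cauchy F ->
  exists U : SM, F --> U.
Proof.
move=> FF /cauchyP cF.
have dec b : F [set V : SM | stone_set V b] \/ F [set V :
  SM | stone_set V (~` b)%O].
  have [/= U FU] := cF _ (@exp2V_gt0 R (ba_code b)).
  have FU' : F [set V : SM | ~~ differ U V (ba_code b)].
    apply: filterS FU => V; rewrite ballEmdist /= => UV;
      apply/negP => /sdist_ge.
    by move=> /(_ R); rewrite leNgt => /negP; exact.
  have [Ub|nUb] := pselect (stone_set U b); [left|right];
    apply: filterS FU' => V;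
    rewrite /differ ba_codeK /= negbK => /eqP; rewrite /=.
    by rewrite asboolT// => /esym/asboolP.
  by rewrite asboolF// => /esym/asboolPn/stoneC.
have [||U UE] := @stone_exists _ A [set b | F [set V : SM | stone_set V b]].
- split=> /=.
  + by apply: filterS filterT => V _; exact: stoneT.
  + by move=> /filter_ex[V /stone0].
  + move=> x y Fx Fy; apply: filterS (filterI Fx Fy) => V [Vx Vy].
    exact/stoneI.
  + by move=> x y Fx xy; apply: filterS Fx => V; exact: stoneS.
- exact: dec.
exists (U : SM) => O /sm_nbhsP[b Ub bO]; apply: filterS bO _.
by move: Ub; rewrite UE.
Qed.

Hypothesis A_nontrivial : (\bot != \top :> A)%O.

Local Notation point := (point A_nontrivial).
Local Notation bit := (bit A).

Lemma sm_dense : @dense SM (range (point : nat -> SM)).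
Proof.
move=> O [U OU] oO.
have /sm_nbhsP[b Ub bO] := open_nbhs_nbhs (conj oO OU).
have b0 : b != \bot%O by apply/eqP => b0; apply: (@stone0 _ _ U); rewrite -b0.
exists (point (ba_code b) : SM); split; last by exists (ba_code b).
by apply: bO => /=; have := point_seed A_nontrivial (ba_code b);
  rewrite seed_code.
Qed.

Lemma asbool_bit i n : `[< stone_set (point i) (ba_decode A n) >] = bit i n.
Proof. by apply/asboolP/idP => /(bitP A_nontrivial). Qed.

Lemma differ_bit i j n : differ (point i) (point j) n = (bit i n != bit j n).
Proof. by rewrite /differ !asbool_bit. Qed.

(** Bounded search as a recursion: the value equals the stage until a difference is found, and
    [r.+1 <= n] says that one was found earlier. If there is none below [k], the value is [k]. *)
Definition first_difference (i j k : nat) : nat :=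
  nat_rect (fun=> nat) 0 (fun n r =>
    if r.+1 <= n then r else if bit i n == bit j n then n.+1 else n) k.

Lemma first_differenceP i j k : let r := first_difference i j k in
  [/\ r <= k, agree (point i) (point j) r & r < k -> differ (point i) (point j)
    r].
Proof.
elim: k => [|k] //=; rewrite -/(first_difference i j k).
set r := first_difference i j k => -[rk ar dr].
case: ifPn => [rltk|].
  by split=> // [|_]; [exact: leqW|exact: dr].
rewrite -leqNgt => kr; have {kr rk dr} rE : r = k by apply/eqP;
  rewrite eqn_leq rk.
rewrite rE in ar; case: ifPn => bk; split.
- exact: leqnn.
- move=> n; rewrite ltnS leq_eqVlt => /orP[/eqP->|]; last exact: ar.
  by rewrite differ_bit negbK.
- by rewrite ltnn.
- exact: leqnSn.
- exact: ar.
- by rewrite differ_bit.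
Qed.

Lemma computable_first_difference :
  computable (fun z : nat * (nat * nat) => first_difference z.1 z.2.1 z.2.2).
Proof.
have cb := computable_bit A.
apply: (@computable_natrec _ _ (fun=> 0) (fun z n r =>
  if r.+1 <= n then r else if bit z.1 n == bit z.2.1 n then n.+1 else n));
    by cmp.
Qed.

(** With [r] the first difference bounded by [k], the approximation [2^-r] is exact for [r < k]; for
    [r = k] both it and the distance lie between 0 and [2^-k]. *)
Lemma sm_computable : uniformly_computable
  (fun i j => mdist (point i : SM) (point j : SM)).
Proof.
have cf := computable_first_difference; have rp := rec1_pred.
have [|q rq qE] := @rec3_tuple (fun i j k => (2 ^ first_difference i j k).-1).
  apply: (@computable_rec3 (fun i j k => (2 ^ first_difference i j k).-1)).
  by cmp.
exists (fun=> 1), (fun=> 0), q; split=> //; [exact: recursive_const..|].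
move=> i j k /=; rewrite qE prednK ?expn_gt0// subr0 mul1r natrX -exprVn.
have [rk /(@sdist_le R) le_r] := first_differenceP i j k.
set r := first_difference i j k in rk le_r *; rewrite /mdist /=.
case: ltnP => [_ /(_ isT)/(@sdist_ge R) ge_r|kr _]; last first.
  have {kr} rk' : r = k by apply/eqP; rewrite eqn_leq rk.
  rewrite rk' in le_r *; have := sdist_ge0 (R := R) (point i) (point j).
  by move: le_r (@exp2V_gt0 R k); move: (sdist _ _) (_ ^+ _)%R => x y;
    rewrite ler_norml; lra.
have -> : sdist (point i) (point j) = (2^-1 ^+ r)%R :> R.
  by apply/eqP; rewrite eq_le le_r.
by rewrite subrr normr0; exact/ltW/exp2V_gt0.
Qed.

Definition stone_space : computablePolishSpace R :=
  ComputablePolishSpace sm_complete sm_dense sm_computable.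

Lemma level_exists (z : nat * nat) : exists n, z.2.+1 < z.1.+1 * 2 ^ n.
Proof.
exists z.2.+1; apply: (@leq_trans (2 ^ z.2.+1)); first exact: ltn_expl.
by rewrite leq_pmull.
Qed.

(** The least [n] with [2^-n] below the radius [(a + 1) / (b + 1)]: the number of coordinates on
    which the points of such a ball agree with its center. *)
Definition level (z : nat * nat) : nat := ex_minn (level_exists z).

(** By monotonicity of [2 ^ n], minimality need only be tested at [n.-1], which makes the defining
    relation decidable. *)
Lemma computable_level : computable level.
Proof.
pose Q (z : nat * nat) n := (z.2.+2 <= z.1.+1 * 2 ^ n) &&
  ((n == 0) || (z.1.+1 * 2 ^ n.-1 <= z.2.+1)).
have rp := rec1_pred.
have cQ : computable (fun w : (nat * nat) * nat => Q w.1 w.2) by rewrite /Q;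
  cmp.
have [| | | |f cf fQ] := @computable_choice (nat * nat)%type nat Q.
- by apply: effective_pair; exact: effective_nat.
- exact: effective_nat.
- exact: (decidable_semidecidable cQ).
- move=> z; exists (level z); rewrite /level /Q;
  case: ex_minnP => n -> n_min /=.
  case: n n_min => //= n n_min; rewrite leqNgt; apply/negP => /n_min.
  by rewrite ltnn.
apply: (computable_ext cf) => z; rewrite /level; case: ex_minnP => n zn n_min.
have /andP[/n_min nf fz] := fQ z; apply/eqP; rewrite eqn_leq nf andbT.
rewrite leqNgt; apply/negP => nf'; move: fz;
  rewrite gtn_eqF ?(leq_ltn_trans _ nf')//=.
rewrite leqNgt => /negP; apply; apply: leq_trans zn _.
by rewrite leq_mul2l leq_exp2l// -ltnS prednK// (leq_ltn_trans _ nf').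
Qed.

Definition ball_element (u : ball_index) : ba_type A :=
  literals (point u.1) (level u.2).

Lemma basic_ball_element u :
  basic_ball stone_space u = [set V | stone_set (V : stone A) (ball_element u)].
Proof.
have qE n : (2^-1 ^+ n < u.2.1.+1%:R / u.2.2.+1%:R :> R)%R =
    (u.2.2.+1 < u.2.1.+1 * 2 ^ n).
  rewrite ltr_pdivlMr ?ltr0n// exprVn mulrC ltr_pdivrMr ?exprn_gt0//.
  by rewrite -natrX -natrM ltr_nat.
apply/seteqP; suff H V : basic_ball stone_space u V <-> stone_set (V :
  stone A) (ball_element u).
  by split=> V /H.
rewrite /ball_element literalsP /level; case: ex_minnP => N uN N_min.
apply: sdist_lt; first by rewrite qE.
by move=> n nN; rewrite leNgt qE; apply/negP => /N_min; rewrite leqNgt nN.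
Qed.

Lemma computable_ball_element : computable ball_element.
Proof.
have [cb cl] := (computable_bit A, computable_level).
have [cm cc] := (@computable_bmeet A, @computable_bcompl A).
have cd := computable_bdecode A.
pose lit (u : ball_index) n : ba_type A :=
  if bit u.1 n then bdecode A n else bcompl (bdecode A n).
apply: (@computable_ext _ _ (fun u : ball_index => nat_rect (fun=> ba_type A)
    (\top%O : A) (fun n c => bmeet c (lit u n)) (level u.2))).
  apply: (@computable_natrec _ _ (fun=> (\top%O : A) : ba_type A)
    (fun u n c => bmeet c (lit u n))); by rewrite ?/lit; cmp.
move=> u; rewrite /ball_element; elim: (level u.2) => //= n ->.
by rewrite /bmeet /lit /literal asbool_bit.
Qed.

(** Turns covering into an equation of the algebra, decidable by comparing codes. *)
Lemma covers_elements s :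
  covers stone_space s <-> joins (map ball_element s : seq A) = \top%O.
Proof.
split=> [cov|s1 V].
  apply: (stone_basic_inj (ba_countable A)); apply/seteqP; split=> V _.
    exact: stoneT.
  apply/joinsP; have [u us] := cov V; rewrite basic_ball_element => uV.
  by exists (ball_element u) => //; exact: (map_f ball_element).
have := stoneT (V : stone A); rewrite -s1 => /joinsP[b /mapP[u us ->] Vb].
by exists u => //; rewrite basic_ball_element.
Qed.

Lemma computable_joins : computable (joins : seq (ba_type A) -> ba_type A).
Proof.
have cj := @computable_bjoin A.
apply: (@computable_foldr _ _ _ (fun _ b c => bjoin b c) (fun=> (\bot%O : A)));
  by cmp.
Qed.

Lemma stone_space_compact : effectively_compact stone_space.
Proof.
apply: semidecidable_ce.
  by apply: effective_seq; do !apply: effective_pair; exact: effective_nat.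
have [ce cj] := (computable_ball_element, computable_joins).
have cs : computable (fun s : seq ball_index =>
    (joins (map ball_element s) : ba_type A) == (\top%O : A)).
  apply: computable_eq; last by cmp.
  apply: (computable_comp cj).
  by apply: (@computable_map _ _ _ (fun _ u => ball_element u)); cmp.
apply: (semidecidable_ext (decidable_semidecidable cs)) => s.
rewrite -(rwP eqP) -(covers_elements s); split=> [cov|sT x].
  by apply/seteqP; split=> // x _; have [u us ux] := cov x; exists u.
have : (\bigcup_(u in [set` s]) basic_ball stone_space u) x by rewrite sT.
by case=> u us ux; exists u.
Qed.

End StonePolish.

(** * The isomorphism dual to an effective homeomorphism *)

Section EffectiveToCategorical.
Context (R : realType) (A A' : computableBooleanAlgebra).
Hypothesis nA : (\bot != \top :> A)%O.
Hypothesis nA' : (\bot != \top :> A')%O.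

Local Notation X := (stone_space R nA').
Local Notation Y := (stone_space R nA).
Local Notation eltX := (ball_element nA').
Local Notation eltY := (ball_element nA).

Variable f : stone A' -> stone A.
Hypothesis hf : @homeomorphism (stone A') (stone A) f.
Variable F : set (ball_index * ball_index).
Hypothesis sF : semidecidable F.
Hypothesis F_sub : forall U V, F (U, V) ->
  (f : X -> Y) @` basic_ball X U `<=` basic_ball Y V.
Hypothesis F_nbhs : forall (x : X) (E : ball_index), basic_ball Y E (f x) ->
  exists2 D, basic_ball X D x & F (D, E).

Lemma preimage_exists (a : A) : exists a' : A',
  f @^-1` stone_basic a = stone_basic a'.
Proof.
apply: (stone_clopen (ba_countable A')).
  by apply: open_comp => [U _|]; [exact: hf.1|exact: stone_basic_open].
rewrite preimage_setC -stone_basicC.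
by apply: open_comp => [U _|]; [exact: hf.1|exact: stone_basic_open].
Qed.

Definition pullback (a : A) : A' := projT1 (cid (preimage_exists a)).

Lemma pullbackE a : stone_basic (pullback a) = f @^-1` stone_basic a.
Proof. by rewrite /pullback; case: cid. Qed.

Lemma pullbackP a U : stone_set U (pullback a) <-> stone_set (f U) a.
Proof. by rewrite -[stone_set U _]/(stone_basic _ U) pullbackE. Qed.

Lemma stone_basic_eq (b c : A') :
  (forall U, stone_set U b <-> stone_set U c) -> b = c.
Proof.
move=> bc; apply: (stone_basic_inj (ba_countable A')).
by apply/seteqP; split=> U /bc.
Qed.

Lemma pullback_isomorphism : boolean_isomorphism pullback.
Proof.
have [_ [g [fK gK cg]]] := hf.
have pI x y : pullback (x `&` y)%O = (pullback x `&` pullback y)%O.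
  by apply: stone_basic_eq => U; rewrite pullbackP !stoneI !pullbackP.
have pU x y : pullback (x `|` y)%O = (pullback x `|` pullback y)%O.
  by apply: stone_basic_eq => U; rewrite pullbackP !stoneU !pullbackP.
have pC x : pullback (~` x)%O = (~` pullback x)%O.
  by apply: stone_basic_eq => U; rewrite pullbackP !stoneC pullbackP.
have p0 : pullback \bot%O = \bot%O.
  by apply: stone_basic_eq => U; rewrite pullbackP; split=> /stone0.
split=> //; last by split=> //; rewrite -compl0 pC p0 compl0.
have inj : injective pullback.
  move=> x y xy; apply: (stone_basic_inj (ba_countable A)).
  by apply/seteqP; split=> U; rewrite /stone_basic /= -(gK U) -!pullbackP xy.
have surj y : exists x, pullback x = y.
  have [||x xE] := @stone_clopen _ A (ba_countable A) (g @^-1` stone_basic y).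
  - by apply: open_comp => [U _|]; [exact: cg|exact: stone_basic_open].
  - rewrite preimage_setC -stone_basicC.
    by apply: open_comp => [U _|]; [exact: cg|exact: stone_basic_open].
  exists x; apply: stone_basic_eq => U; rewrite pullbackP.
  by rewrite -[stone_set (f U) x]/(stone_basic x (f U)) -xE /preimage /= fK.
exists (fun y => projT1 (cid (surj y))) => [x|y]; last by case: cid.
by case: cid => z /= /inj.
Qed.

(* Semidecidable form of [a' <= pullback a]: finitely many pairs of [F] witness
   that [f] maps [a'] into [a]. *)
Let below (a : ba_type A) (a' : ba_type A') : Prop :=
  exists L : seq (ball_index * ball_index),
    (forall w, w \in L -> F w /\ ble (eltY w.2) a) /\
    ble a' (joins (map (fun w => eltX w.1 : A') L)).

(** If [L] is given, an ultrafilter through [a'] lies in some listed [D], so its image lies in the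
    matching [E], inside [a]. Conversely, [F_nbhs] gives such a pair at each ultrafilter through
    [a'], and compactness leaves finitely many. *)
Lemma belowP a a' : below a a' <-> (a' <= pullback a :> A')%O.
Proof.
split=> [[L [LF a'L]]|a'a].
  apply: (stone_basic_le (ba_countable A')) => U Ua'; apply/pullbackP.
  have /joinsP[b /mapP[[D E] /LF[DE Ea] ->] Ub] := stoneS a'L Ua'.
  apply: (stoneS Ea).
  have : basic_ball Y E (f U).
    by apply: (F_sub DE); exists U => //; rewrite basic_ball_element.
  by rewrite basic_ball_element.
(* The complement of [a'] completes the cover to the whole space; it is dropped when the list [L] is
   formed. *)
pose P (b : A') := b = (~` (a' : A'))%O \/
  exists2 w, F w /\ ble (eltY w.2) a & b = eltX w.1.
have [U|s sP s1] := @stone_compact _ A' (ba_countable A') P.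
  have [Ua'|/stoneC nUa'] := pselect (stone_set U (a' : A')); last first.
    by exists (~` (a' : A'))%O => //; left.
  have fUa : stone_set (f U) (a : A) by apply/pullbackP; exact: stoneS Ua'.
  have : @nbhs _ Y (f U : Y) [set V : stone A | stone_set V (a : A)].
    by apply/sm_nbhsP; exists (a : A).
  move=> /nbhs_small_ball[E fE Ea]; have [D DU DE] := F_nbhs fE.
  exists (eltX D); last by move: DU; rewrite basic_ball_element.
  right; exists (D, E) => //; split=> //.
  apply: (stone_basic_le (ba_countable A)) => V VE; apply: Ea.
  have : basic_ball Y E V by rewrite basic_ball_element.
  rewrite /basic_ball /= -/(@radius R E) => /lt_trans; apply.
  by have := @radius_gt0 R E; lra.
have [L LF sL] : exists2 L : seq (ball_index * ball_index),
    (forall w, w \in L -> F w /\ ble (eltY w.2) a) &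
    forall b, b \in s -> b = (~` (a' : A'))%O \/ b \in map (fun w =>
      eltX w.1 : A') L.
  elim: s sP {s1} => [|b s ih] sP; first by exists [::].
  have [|L LF sL] := ih; first by move=> c cs; apply: sP; rewrite inE cs orbT.
  have [bE|[w Fw bE]] := sP b (mem_head _ _).
    by exists L => // c; rewrite inE => /orP[/eqP->|/sL]; first by left.
  exists (w :: L) => [v|c]; first by rewrite inE => /orP[/eqP->|/LF].
  rewrite inE /= inE => /orP[/eqP->|/sL[->|cL]]; [|by left|]; right.
    by rewrite bE eqxx.
  by rewrite cL orbT.
exists L; split=> //; apply: (stone_basic_le (ba_countable A')) => U Ua'.
apply/joinsP; have := stoneT U; rewrite -s1 => /joinsP[b bs Ub].
by have [bE|bL] := sL b bs; [case: ((stoneC U a').1 _ Ua');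
  rewrite -bE|exists b].
Qed.

Lemma semidecidable_below :
  semidecidable (fun z : ba_type A * ba_type A' => below z.1 z.2).
Proof.
have [cX cY] := (computable_ball_element nA', computable_ball_element nA).
have [cl cl'] := (@computable_ble A, @computable_ble A').
have cj := computable_joins A'.
apply: semidecidable_exists.
  by apply: effective_seq; do !apply: effective_pair; exact: effective_nat.
apply: semidecidable_and.
  apply: (@semidecidable_all _ _ (fun z w => F w /\ ble (eltY w.2) z.1.1));
    last by cmp.
  apply: semidecidable_and; last by apply: decidable_semidecidable; cmp.
  by apply: (semidecidable_comp _ sF); cmp.
apply: decidable_semidecidable.
have cm : computable (fun z : (ba_type A * ba_type A') * seq (ball_index *
  ball_index) =>
    (map (fun w => eltX w.1) z.2 : seq (ba_type A'))).
  by apply: (@computable_map _ _ _ (fun _ w => eltX w.1)); cmp.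
have cjm := computable_comp cj cm.
exact: (computable_uncurry cl' (computable_snd (computable_fst (computable_id
  _))) cjm).
Qed.

(** Both [a' <= pullback a] and the same inequality between complements are semidecidable, and
    together they single out [pullback a], which a search therefore finds. *)
Lemma pullback_computable : computably_isomorphic A A'.
Proof.
exists pullback; split; first exact: pullback_isomorphism.
have [_ _ _ _ pC] := pullback_isomorphism.
pose Q (a : ba_type A) (a' : ba_type A') :=
  below a a' /\ below (bcompl a) (bcompl a').
have QP a a' : Q a a' <-> a' = pullback a.
  rewrite /Q !belowP /bcompl pC leC; split=> [[a1 a2]|->]; last by rewrite lexx.
  by apply/eqP; rewrite eq_le a1.
have [| | | |p [g rg pg] pQ] := @computable_choice (ba_type A) (ba_type A') Q.
- exact: effective_ba.
- exact: effective_ba.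
- have [cc cc'] := (@computable_bcompl A, @computable_bcompl A').
  apply: semidecidable_and; first exact: semidecidable_below.
  apply: (@semidecidable_comp _ _ _ (fun z => (bcompl z.1,
    bcompl z.2)) _ semidecidable_below).
  by cmp.
- by move=> a; exists (pullback a); apply/QP.
have [c rc cE] := rec1_tuple rg; exists c => // a.
by rewrite cE -[RHS](pg a); have /QP-> := pQ a.
Qed.

End EffectiveToCategorical.

(** The Stone space of a one-element algebra is empty and has no special points, so this case is
    settled without topology. *)
Lemma trivial_isomorphic (A A' : computableBooleanAlgebra) :
  (\bot = \top :> A)%O -> (\bot = \top :> A')%O -> computably_isomorphic A A'.
Proof.
move=> tA tA'.
have all1 (a : A) : a = \top%O by apply/eqP; rewrite -le1x -tA le0x.
have all1' (a : A') : a = \top%O by apply/eqP; rewrite -le1x -tA' le0x.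
exists (fun=> \top%O); split; last first.
  by exists (fun=> ba_code (\top%O : A')) => //; exact: recursive_const.
split=> [||x y|x y|x]; last 3 first; try by symmetry; exact: all1'.
- by exists (fun=> \top%O) => a; symmetry; [exact: all1|exact: all1'].
- by split=> //; exact/esym.
Qed.

Lemma effective_categorical (R : realType) (B : computableBooleanAlgebra) :
  effectively_categorical R (stone B) -> computably_categorical B.
Proof.
move=> effB A A' copyA copyA'.
have copy_trivial C : computable_copy C B -> (\bot == \top :> C)%O = (\bot ==
  \top :> B)%O.
  move=> [p [[q pK qK] [p0 p1] _ _ _]].
  by rewrite -p0 -p1 (inj_eq (can_inj pK)).
have [tB|nB] := boolP (\bot == \top :> B)%O.
  by apply: trivial_isomorphic; apply/eqP; rewrite copy_trivial.
have nA : (\bot != \top :> A)%O by rewrite copy_trivial.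
have nA' : (\bot != \top :> A')%O by rewrite copy_trivial.
have homeo (C : computableBooleanAlgebra) (nC : (\bot != \top :> C)%O) :
  computable_copy C B ->
    homeomorphic (stone_space R nC) (stone B).
  move=> /homeomorphic_stone[h hh]; exists (h \o id).
  exact: homeomorphism_comp (sm_homeomorphism R C) hh.
(* Duality reverses arrows: a map from the space of [A'] to that of [A] yields the isomorphism from
   [A] to [A']. *)
have [f [hf [F [/ce_semidecidable sF F_sub F_nbhs]]]] :=
  effB _ _ (stone_space_compact R nA') (stone_space_compact R nA)
    (homeo _ nA' copyA') (homeo _ nA copyA).
have [g [hg gK _]] := homeomorphism_inv (sm_homeomorphism R A').
(* [f] is a homeomorphism for the metric topologies; composing with the identity maps to and from
   the Stone topologies transfers this. *)
have hf' : @homeomorphism (stone A') (stone A) f.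
  suff -> : f = id \o (f \o g).
    exact: homeomorphism_comp (homeomorphism_comp hg hf) (sm_homeomorphism R A).
  by apply/funext => U /=; rewrite (gK U).
exact: (pullback_computable hf' sF F_sub F_nbhs).
Qed.

Theorem theorem1p3 (R : realType) (B : computableBooleanAlgebra) :
  computably_categorical B <-> effectively_categorical R (stone B).
Proof. split; [exact: categorical_effective|exact: effective_categorical]. Qed.
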